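(* Let $\Lambda$ be a finitely aligned $k$-graph and let $X\subseteq\Lambda^0$ be non-empty. Then $C^*(\Lambda,X)$ is a full corner of $C^*(\Lambda,\Lambda^0)$ if and only if $\Sigma(X)=\Lambda^0$, where $\Sigma(X)$ is the saturation of $X$.
   Context: $\mathbb{N}=\{0,1,2,\dots\}$; $\mathbb{N}^k$ is ordered coordinatewise and $m\vee n$ is the coordinatewise maximum. A $k$-graph $(\Lambda,d)$ is a countable category $\Lambda$ (identified with its set of morphisms, called paths) with a degree functor $d:\Lambda\to\mathbb{N}^k$ satisfying the factorisation property: if $d(\lambda)=m+n$ there are unique $\mu,\nu$ with $d(\mu)=m$, $d(\nu)=n$, $\lambda=\mu\nu$. The codomain and domain maps are $r$ and $s$, so $\lambda\mu$ is defined iff $s(\lambda)=r(\mu)$. $\Lambda^n=d^{-1}(n)$, and objects (vertices) are identified with $\Lambda^0$. For $v\in\Lambda^0$ and $X\subseteq\Lambda^0$, $v\Lambda=\{\lambda:r(\lambda)=v\}$, $X\Lambda=\{\lambda:r(\lambda)\in X\}$, $v\Lambda X=\{\lambda:r(\lambda)=v,\ s(\lambda)\in X\}$. $\Lambda^{\min}(\lambda,\mu)=\{(\alpha,\beta):\lambda\alpha=\mu\beta,\ d(\lambda\alpha)=d(\lambda)\vee d(\mu)\}$; $\Lambda$ is finitely aligned if $\Lambda^{\min}(\lambda,\mu)$ is finite (possibly empty) for all $\lambda,\mu$. A set $E\subset v\Lambda$ is exhaustive if for every $\mu\in v\Lambda$ there is $\lambda\in E$ with $\Lambda^{\min}(\lambda,\mu)\ne\emptyset$.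 For non-empty $X\subseteq\Lambda^0$, a Cuntz-Krieger $(\Lambda,X)$-family is a collection of partial isometries $\{T_{\alpha,\beta}:\alpha,\beta\in X\Lambda,\ s(\alpha)=s(\beta)\}$ in a $C^*$-algebra, with $T_\lambda:=T_{\lambda,\lambda}$, such that for all $\alpha,\beta,\lambda,\mu\in X\Lambda$ with $s(\alpha)=s(\beta)$ and $s(\lambda)=s(\mu)$: (i) $T_{\alpha,\beta}^*=T_{\beta,\alpha}$; (ii) $T_{\alpha,\beta}T_{\lambda,\mu}=\sum_{(\beta',\lambda')\in\Lambda^{\min}(\beta,\lambda)}T_{\alpha\beta',\mu\lambda'}$; (iii) $\prod_{\lambda\in E}(T_v-T_\lambda)=0$ for all $v\in X$ and all finite exhaustive $E\subset v\Lambda$. $C^*(\Lambda,X)$ is the universal $C^*$-algebra generated by a Cuntz-Krieger $(\Lambda,X)$-family. Via the map $T_{\alpha,\beta}\mapsto T_{\alpha,\beta}$ on generators, $C^*(\Lambda,X)$ is identified with the corner $P_X\,C^*(\Lambda,\Lambda^0)\,P_X$, where $P_X=\sum_{v\in X}T_v\in\mathcal{M}(C^*(\Lambda,\Lambda^0))$ (strict convergence). The corner is full if the closed two-sided ideal generated by $P_X$ is all of $C^*(\Lambda,\Lambda^0)$. $H\subset\Lambda^0$ is hereditary if $v\Lambda=v\Lambda H$ for all $v\in H$. $S\subset\Lambda^0$ is saturated if $v\in S$ whenever $v\in\Lambda^0$ and there is a finite exhaustive set $E\subset v\Lambda$ with $E\subset v\Lambda S$. The saturation $\Sigma(V)$ of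 $V\subseteq\Lambda^0$ is the smallest saturated and hereditary subset of $\Lambda^0$ containing $V$.
   Formalization: ''C*(Λ,X) is a full corner'' is read as: the canonical map from C*(Λ,X) has range exactly P_X C*(Λ,Λ⁰) P_X and this corner is full; injectivity of the map is not claimed, since with relation (iii) imposed only at v in X it can fail. *)

(* Defs.v *)
From HB Require Import structures.
From mathcomp Require Import all_boot all_order all_algebra finmap.
From mathcomp Require Import all_classical all_reals all_analysis summability.
From mathcomp Require Import complex.

Set Implicit Arguments.
Unset Strict Implicit.
Unset Printing Implicit Defensive.

Import Order.TTheory GRing.Theory Num.Theory numFieldNormedType.Exports.
Local Open Scope classical_set_scope.
Local Open Scope ring_scope.

(** * C*-algebras *)

Reserved Notation "x ** y" (at level 40, left associativity).

(* Complex C*-algebras, not necessarily unital: the product is therefore not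
   the one of a [pzRingType].  The norm takes its values in R[i]. *)
HB.mixin Record CompleteNormedModule_isCStarAlgebra (R : realType) A
    of CompleteNormedModule R[i] A := {
  cmul : A -> A -> A;
  adj : A -> A;
  cmulA : associative cmul;
  cmulDl : left_distributive cmul +%R;
  cmulDr : right_distributive cmul +%R;
  scaler_cmull : forall (a : R[i]) x y, a *: cmul x y = cmul (a *: x) y;
  scaler_cmulr : forall (a : R[i]) x y, a *: cmul x y = cmul x (a *: y);
  ler_norm_cmul : forall x y, `|cmul x y| <= `|x| * `|y|;
  adjK : involutive adj;
  adjD : forall x y, adj (x + y) = adj x + adj y;
  adjZ : forall (a : R[i]) x, adj (a *: x) = Num.conj a *: adj x;
  adjM : forall x y, adj (cmul x y) = cmul (adj y) (adj x);
  norm_adj_cmul : forall x, `|cmul (adj x) x| = `|x| ^+ 2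
}.

#[short(type="cstarType")]
HB.structure Definition CStarAlgebra (R : realType) :=
  {A of CompleteNormedModule R[i] A & CompleteNormedModule_isCStarAlgebra R A}.

Notation "x ** y" := (cmul x y) : ring_scope.

Section CStar.
Context {R : realType}.
Implicit Types A B : cstarType R.

Definition star_hom A B (f : {linear A -> B}) : Prop :=
  (forall x y, f (x ** y) = f x ** f y) /\ (forall x, f (adj x) = adj (f x)).

Definition partial_isometry A (x : A) : Prop := x ** adj x ** x = x.

Definition closed_star_subalgebra A (D : set A) : Prop :=
  [/\ closed D, D 0,
      forall (a : R[i]) x y, D x -> D y -> D (a *: x + y),
      forall x y, D x -> D y -> D (x ** y)
    & forall x, D x -> D (adj x)].

Definition generated_by A (G : set A) : Prop :=
  forall D : set A, closed_star_subalgebra D -> G `<=` D -> D = setT.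

Definition closed_ideal A (I : set A) : Prop :=
  [/\ closed I, I 0,
      forall (a : R[i]) x y, I x -> I y -> I (a *: x + y)
    & forall x y, I y -> I (x ** y) /\ I (y ** x)].

(* The empty product has no meaning in a non-unital algebra; [0] is a dummy
   value. *)
Definition prod_seq A (s : seq A) : A :=
  if s is x :: s' then foldl cmul x s' else 0.

(* Multipliers as double centralisers: [lmult P a] is [P a] and [rmult P a]
   is [a P]. *)
Record multiplier A := Multiplier {
  lmult : {linear A -> A};
  rmult : {linear A -> A};
  lmult_continuous : continuous lmult;
  rmult_continuous : continuous rmult;
  lmultM : forall x y, lmult (x ** y) = lmult x ** y;
  rmultM : forall x y, rmult (x ** y) = x ** rmult y;
  lrmultM : forall x y, x ** lmult y = rmult x ** y
}.

Definition strict_cvg A (I : Type) (F : set_system I) (x : I -> A)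
    (P : multiplier A) : Prop :=
  forall a : A, ((fun i => x i ** a) @ F --> lmult P a) /\
                ((fun i => a ** x i) @ F --> rmult P a).

Definition corner A (P : multiplier A) : set A :=
  [set lmult P (rmult P a) | a in setT].

Definition ideal_generated A (P : multiplier A) : set A :=
  \bigcap_(I in [set I : set A | closed_ideal I /\
                 forall a b, I (a ** lmult P b)]) I.

End CStar.

(** * Higher-rank graphs *)

(* A countable category with objects [kvertex] and morphisms [kpath].  The
   composite [pcomp l m] is only meaningful when [src l = rng m]. *)
Record kgraph (k : nat) := KGraph {
  kvertex : countType;
  kpath : countType;
  rng : kpath -> kvertex;
  src : kpath -> kvertex;
  idp : kvertex -> kpath;
  pcomp : kpath -> kpath -> kpath;
  deg : kpath -> {ffun 'I_k -> nat};
  rng_idp : forall v, rng (idp v) = v;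
  src_idp : forall v, src (idp v) = v;
  rng_pcomp : forall l m, src l = rng m -> rng (pcomp l m) = rng l;
  src_pcomp : forall l m, src l = rng m -> src (pcomp l m) = src m;
  pcomp_idl : forall l, pcomp (idp (rng l)) l = l;
  pcomp_idr : forall l, pcomp l (idp (src l)) = l;
  pcompA : forall l m n, src l = rng m -> src m = rng n ->
    pcomp l (pcomp m n) = pcomp (pcomp l m) n;
  deg_idp : forall v, deg (idp v) = 0;
  deg_pcomp : forall l m, src l = rng m -> deg (pcomp l m) = deg l + deg m;
  factorisation : forall l (m n : {ffun 'I_k -> nat}), deg l = m + n ->
    exists! p : kpath * kpath,
      [/\ deg p.1 = m, deg p.2 = n, src p.1 = rng p.2 & l = pcomp p.1 p.2]
}.

Section KGraph.
Context {k : nat} {L : kgraph k}.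
Implicit Types (v : kvertex L) (X H S : set (kvertex L)).

Definition djoin (m n : {ffun 'I_k -> nat}) : {ffun 'I_k -> nat} :=
  [ffun i => maxn (m i) (n i)].

Definition paths_to v : set (kpath L) := [set l | rng l = v].

Definition paths_between v X : set (kpath L) :=
  [set l | rng l = v /\ X (src l)].

Definition Lmin (l m : kpath L) : set (kpath L * kpath L) :=
  [set p | [/\ src l = rng p.1, src m = rng p.2,
               pcomp l p.1 = pcomp m p.2
             & deg (pcomp l p.1) = djoin (deg l) (deg m)]].

Definition exhaustive v (E : set (kpath L)) : Prop :=
  E `<=` paths_to v /\
  forall m, paths_to v m -> exists2 l, E l & Lmin l m !=set0.

Definition hereditary H : Prop :=
  forall v, H v -> paths_to v = paths_between v H.

Definition saturated S : Prop :=
  forall v, (exists E : {fset kpath L},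
    exhaustive v [set` E] /\ [set` E] `<=` paths_between v S) -> S v.

Definition saturation X : set (kvertex L) :=
  \bigcap_(S in [set S | [/\ saturated S, hereditary S & X `<=` S]]) S.

End KGraph.

Definition finitely_aligned (k : nat) (L : kgraph k) : Prop :=
  forall l m : kpath L, finite_set (Lmin l m).

(** * Cuntz-Krieger families *)

Section CuntzKrieger.
Context {R : realType} {k : nat} {L : kgraph k}.
Implicit Types (A B : cstarType R) (X : set (kvertex L)).

(* The pairs indexing a (Lambda, X)-family.  Families are represented by total
   functions, whose values at other pairs are irrelevant. *)
Definition ck_index X (a b : kpath L) : Prop :=
  [/\ X (rng a), X (rng b) & src a = src b].

(* The factors of the product commute, so that the order in which [E] is
   enumerated is immaterial; an exhaustive set is never empty. *)
Definition ck_family X A (T : kpath L -> kpath L -> A) : Prop :=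
  [/\ forall a b, ck_index X a b -> partial_isometry (T a b),
      forall a b, ck_index X a b -> adj (T a b) = T b a,
      forall a b l m, ck_index X a b -> ck_index X l m ->
        T a b ** T l m =
        \sum_(p \in Lmin b l) T (pcomp a p.1) (pcomp m p.2)
    & forall v (E : {fset kpath L}), X v -> exhaustive v [set` E] ->
        prod_seq [seq T (idp v) (idp v) - T l l | l <- enum_fset E] = 0].

(* [A], with the family [T], is C*(Lambda, X). *)
Definition universal_ck X A (T : kpath L -> kpath L -> A) : Prop :=
  [/\ ck_family X T,
      generated_by [set x | exists a b, ck_index X a b /\ x = T a b]
    & forall (C : cstarType R) (S : kpath L -> kpath L -> C), ck_family X S ->
        exists2 f : {linear A -> C}, star_hom f &
          forall a b, ck_index X a b -> f (T a b) = S a b].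

(* [P] is the strict sum of the [T_v] for [v] in [X]. *)
Definition vertex_projection X A (T : kpath L -> kpath L -> A)
    (P : multiplier A) : Prop :=
  strict_cvg totally
    (fun F : {fset kvertex L} => \sum_(v <- F | v \in X) T (idp v) (idp v)) P.

(* For (A, T) = C*(Lambda, Lambda^0) and (B, U) = C*(Lambda, X): the map
   [U a b |-> T a b] takes C*(Lambda, X) onto the corner P_X A P_X, and this
   corner is full.  Faithfulness of that map is not part of the definition,
   since it has nothing to do with fullness and can fail: for the 1-graph with
   vertices u, v, w, one edge from u to w and infinitely many edges e_i from w
   to v, every finite exhaustive subset of v Lambda contains v, so that the
   relations of a (Lambda, {v})-family do not force T_(e_i) = T_(e_i f), where
   f is the edge from u to w, whereas T_w = T_f in C*(Lambda, Lambda^0). *)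
Definition full_corner X A (T : kpath L -> kpath L -> A)
    B (U : kpath L -> kpath L -> B) : Prop :=
  exists (f : {linear B -> A}) (P : multiplier A),
    [/\ star_hom f,
        forall a b, ck_index X a b -> f (U a b) = T a b,
        vertex_projection X T P,
        range f = corner P
      & ideal_generated P = setT].

End CuntzKrieger.

(* Main.v *)
From HB Require Import structures.
Require Import Defs.
From mathcomp Require Import all_boot all_order all_algebra finmap.
From mathcomp Require Import all_classical all_reals all_analysis summability.
From mathcomp Require Import complex ring lra.

(* A *-homomorphism [f] of C*-algebras is contractive with closed range, by
   unitaries instead of spectral theory.  For [x] self-adjoint with [|x| < 1]
   the equation [(1 - y)^2 = 1 - x^2] has a solution [y] commuting with [x], so
   that [f x + i (1 - f y)] is unitary and [|f x| <= 1].  Likewise [2 w] with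
   [w = x / (1 + x^2)] is the real part of a unitary; hence an element [f x] of
   norm at most 1 is approximated up to 3/4 by [f w] with [|w| <= 1/2], and successive
   approximation gives bounded preimages in the closure of the range.

   P_X is the strict limit of the finite sums of vertex projections.  The map
   from C*(L, X) has closed range, and this range contains P_X T_(a,b) P_X for
   all generators, hence is the corner.  For a closed ideal [I] the vertices [v]
   with [T_v] in [I] form a saturated hereditary set, so the corner is full when
   the saturation of [X] is everything.

   Conversely let [S] be a saturated hereditary set containing [X] but not [w].
   The operators on l2 of the set of boundary paths avoiding [S] that replace an
   initial segment [b] by [a] form a Cuntz-Krieger family which vanishes at [X].
   Since [S] is saturated and [L] finitely aligned, a path starting at [w] can be
   extended outside [S] through all the finite exhaustive sets it meets; so
   there is such a boundary path at [w] and the family does not vanish at [w].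
   The kernel of the induced representation is a proper closed ideal
   containing the one generated by P_X. *)

Set Implicit Arguments.
Unset Strict Implicit.
Unset Printing Implicit Defensive.

Import Order.TTheory GRing.Theory Num.Theory numFieldNormedType.Exports.
Local Open Scope classical_set_scope.
Local Open Scope ring_scope.

#[local] Existing Instance totally_filter.

(** * *-homomorphisms *)

Section RealNorm.
Context {R : realType} {V : completeNormedModType R[i]}.
Implicit Types (x y : V) (e : R).

(** The norm lives in [R[i]] but is a nonnegative real there, so its real part loses nothing and
    permits order arguments in [R]. *)
Definition rnorm x : R := complex.Re `|x|.

Lemma normr_rnorm x : `|x| = (rnorm x)%:C%C.
Proof. by rewrite /rnorm RRe_real// ger0_real. Qed.

Lemma rnorm_ge0 x : 0 <= rnorm x.
Proof. by rewrite -ler0c -normr_rnorm. Qed.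

Lemma rnorm0 : rnorm (0 : V) = 0.
Proof. by rewrite /rnorm normr0. Qed.

Lemma rnorm_eq0 x : rnorm x = 0 -> x = 0.
Proof. by move=> x0; apply/normr0_eq0; rewrite normr_rnorm x0. Qed.

Lemma rnormD x y : rnorm (x + y) <= rnorm x + rnorm y.
Proof. by rewrite -lecR rmorphD/= -!normr_rnorm ler_normD. Qed.

Lemma rnormN x : rnorm (- x) = rnorm x.
Proof. by rewrite /rnorm normrN. Qed.

Lemma rnormC x y : rnorm (x - y) = rnorm (y - x).
Proof. by rewrite -rnormN opprB. Qed.

Lemma rnormB x y : rnorm (x - y) <= rnorm x + rnorm y.
Proof. by rewrite -(rnormN y) rnormD. Qed.

Lemma rnorm_dist x y z : rnorm (x - z) <= rnorm (x - y) + rnorm (y - z).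
Proof. by rewrite (le_trans _ (rnormD _ _))// addrA subrK. Qed.

Lemma rnormZr e x : rnorm (e%:C%C *: x) = `|e| * rnorm x.
Proof.
apply: complexI; rewrite rmorphM/= -!normr_rnorm normrZ normc_def /=.
by rewrite expr0n addr0 sqrtr_sqr.
Qed.

Lemma rnormZi x : rnorm ('i%C *: x) = rnorm x.
Proof. by rewrite /rnorm normrZ normc_def/= expr0n expr1n add0r sqrtr1 mul1r. Qed.

Lemma scale_half x : (2^-1 : R)%:C%C *: (x + x) = x.
Proof.
rewrite scalerDr -scalerDl -rmorphD/= (_ : 2^-1 + 2^-1 = 1 :> R) ?scale1r//.
by field.
Qed.

Lemma closed_rnormP (D : set V) : closed D <->
  forall x, (forall e, 0 < e -> exists2 y, D y & rnorm (x - y) < e) -> D x.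
Proof.
split=> [cD x xD|H x xD].
  apply: cD => B /nbhs_ballP[e /= e0 eB].
  have re : e = (complex.Re e)%:C%C by rewrite RRe_real// ger0_real// ltW.
  have [|y Dy xy] := xD (complex.Re e); first by rewrite -ltcR -re.
  exists y; split=> //; apply: eB; rewrite -ball_normE /ball_/=.
  by rewrite normr_rnorm re ltcR.
apply: H => e e0; have [|y [Dy]] := xD (ball x e%:C%C).
  by apply: nbhsx_ballx; rewrite ltcR.
by rewrite -ball_normE /ball_/= normr_rnorm ltcR => ?; exists y.
Qed.

Lemma cvg_rnormP (T : Type) (F : set_system T) {FF : Filter F} (g : T -> V) l :
  g @ F --> l <-> forall e, 0 < e -> \forall t \near F, rnorm (l - g t) < e.
Proof.
split=> [/cvgrPdist_lt H e e0|H].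
  have : 0 < e%:C%C by rewrite ltcR.
  move/H; apply: filterS => t; by rewrite normr_rnorm ltcR.
apply/cvgrPdist_lt => e e0.
have re : e = (complex.Re e)%:C%C by rewrite RRe_real// ger0_real// ltW.
have /H : 0 < complex.Re e by rewrite -ltcR -re.
by apply: filterS => t; rewrite normr_rnorm {2}re ltcR.
Qed.

Lemma cauchy_rnorm (T : Type) (F : set_system T) {FF : ProperFilter F} (g : T -> V) :
  (forall e, 0 < e -> exists x, \forall t \near F, rnorm (x - g t) < e) ->
  exists l : V, g @ F --> l.
Proof.
move=> H; suff : cvg (g @ F) by move/cvg_ex.
apply/cauchy_cvgP/cauchy_exP => e e0.
have re : e = (complex.Re e)%:C%C by rewrite RRe_real// ger0_real// ltW.
have /H[x xF] : 0 < complex.Re e by rewrite -ltcR -re.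
exists x; apply: filterS xF => t.
by rewrite -ball_normE /ball_/= normr_rnorm {2}re ltcR.
Qed.

Lemma geometric_cvg (u : nat -> V) (C q : R) : 0 <= C -> 0 <= q -> q < 1 ->
  (forall n, rnorm (u n.+1 - u n) <= C * q ^+ n) ->
  exists2 l : V, u @ \oo --> l & forall n, rnorm (l - u n) <= C * q ^+ n / (1 - q).
Proof.
move=> C0 q0 q1 uC.
have q1' : 0 < 1 - q by rewrite subr_gt0.
(* The partial geometric sum is kept exact: with the factor [1 - q ^+ m] the induction on [m] closes
   as an identity. *)
have dist m n : rnorm (u (n + m)%N - u n) <= C * q ^+ n / (1 - q) * (1 - q ^+ m).
  elim: m => [|m IHm]; first by rewrite addn0 subrr rnorm0 expr0 subrr mulr0.
  rewrite addnS (le_trans (rnorm_dist _ (u (n + m)%N) _))//.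
  rewrite (le_trans (lerD (uC _) IHm))// exprD exprS le_eqVlt; apply/orP; left.
  by apply/eqP; field; rewrite gt_eqF.
have dist' m n : (n <= m)%N -> rnorm (u m - u n) <= C * q ^+ n / (1 - q).
  move=> /subnKC <-; rewrite (le_trans (dist _ _))// ler_piMr//.
    by rewrite !mulr_ge0 ?exprn_ge0// invr_ge0 ltW.
  by rewrite gerBl exprn_ge0.
have to0 : (fun n => C * q ^+ n / (1 - q)) @ \oo --> (0 : R).
  rewrite (_ : (fun n => _) = geometric (C / (1 - q)) q); last first.
    by apply/funext => n; rewrite /geometric/= mulrAC.
  by apply: cvg_geometric; rewrite ger0_norm.
have [e e0|l ul] := @cauchy_rnorm _ \oo _ u.
  have [N _ /(_ N (leqnn N))] := (cvgrPdist_lt _ _).1 to0 e e0.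
  rewrite /= sub0r normrN => Ne; exists (u N); exists N => // m /= Nm.
  rewrite rnormC (le_lt_trans (dist' _ _ Nm))// (le_lt_trans (ler_norm _))//.
exists l => // n; apply/ler_addgt0Pr => e e0.
have [N _ /(_ (maxn N n) (leq_maxl _ _))/= Ne] := (cvg_rnormP _ _).1 ul e e0.
rewrite [leRHS]addrC (le_trans (rnorm_dist _ (u (maxn N n)) _))// lerD//.
  exact: ltW.
by apply: dist'; exact: leq_maxr.
Qed.

Lemma closed_cvg_rnorm (D : set V) (T : Type) (F : set_system T) {FF : ProperFilter F}
  (g : T -> V) l : closed D -> (forall t, D (g t)) -> g @ F --> l -> D l.
Proof. by move=> cD Dg; apply: closed_cvg => //; apply: nearW. Qed.

Lemma cvg_rnorm_unique (T : Type) (F : set_system T) {FF : ProperFilter F}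
  (g : T -> V) (l l' : V) : g @ F --> l -> g @ F --> l' -> l = l'.
Proof. by apply: cvg_unique; exact: norm_hausdorff. Qed.

End RealNorm.

Lemma lipschitz_rnorm (R : realType) (V W : completeNormedModType R[i])
  (f : V -> W) (C : R) :
  (forall x y, rnorm (f x - f y) <= C * rnorm (x - y)) -> continuous f.
Proof.
move=> fC x; apply/cvg_rnormP => e e0.
have C1 : 0 < `|C| + 1 by rewrite ltr_wpDl.
have /(cvg_rnormP _ _).1/(_ (e / (`|C| + 1))) : (y @[y --> x] --> x) by [].
move=> /(_ (divr_gt0 e0 C1)); apply: filterS => y xy.
rewrite (le_lt_trans (fC _ _))//.
rewrite (@le_lt_trans _ _ ((`|C| + 1) * rnorm (x - y)))//.
  by rewrite ler_wpM2r ?rnorm_ge0// (le_trans (ler_norm _))// lerDl.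
by rewrite mulrC -ltr_pdivlMr.
Qed.

Lemma closed_preimage (T U : topologicalType) (f : T -> U) (D : set U) :
  continuous f -> closed D -> closed [set x | D (f x)].
Proof. by move=> cf cD; apply: (@preimage_closed T U f D) => // x _; exact: cf. Qed.

Lemma closed_equalizer (R : realType) (V W : completeNormedModType R[i])
  (f g : V -> W) : continuous f -> continuous g -> closed [set x | f x = g x].
Proof.
move=> cf cg; have -> : [set x | f x = g x] = [set x | [set 0] (f x - g x)].
  by apply/seteqP; split=> x /= => [->|/subr0_eq]//; rewrite subrr.
apply: closed_preimage.
  by move=> x; apply: cvgB; [exact: cf | exact: cg].
by apply: accessible_closed_set1; apply: hausdorff_accessible; exact: norm_hausdorff.
Qed.

(** * Unitaries, square roots and resolvents in a C*-algebra *)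

Section CStarTheory.
Context {R : realType} {A : cstarType R}.
Implicit Types (x y z a c : A) (e : R).

Lemma cmul0l y : 0 ** y = 0 :> A.
Proof. by apply: (addrI (0 ** y)); rewrite -cmulDl !addr0. Qed.

Lemma cmul0r x : x ** 0 = 0 :> A.
Proof. by apply: (addrI (x ** 0)); rewrite -cmulDr !addr0. Qed.

Lemma cmulNl x y : (- x) ** y = - (x ** y).
Proof. by apply: (addrI (x ** y)); rewrite -cmulDl !subrr cmul0l. Qed.

Lemma cmulNr x y : x ** (- y) = - (x ** y).
Proof. by apply: (addrI (x ** y)); rewrite -cmulDr !subrr cmul0r. Qed.

Lemma cmulBl x y z : (x - y) ** z = x ** z - y ** z.
Proof. by rewrite cmulDl cmulNl. Qed.

Lemma cmulBr x y z : z ** (x - y) = z ** x - z ** y.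
Proof. by rewrite cmulDr cmulNr. Qed.

Lemma cmulZl (r : R[i]) x y : (r *: x) ** y = r *: (x ** y).
Proof. by rewrite scaler_cmull. Qed.

Lemma cmulZr (r : R[i]) x y : x ** (r *: y) = r *: (x ** y).
Proof. by rewrite scaler_cmulr. Qed.

Lemma cmul_suml (I : Type) (s : seq I) (P : pred I) (F : I -> A) y :
  (\sum_(i <- s | P i) F i) ** y = \sum_(i <- s | P i) F i ** y.
Proof. by elim/big_rec2: _ => [|i u v _ <-]; rewrite ?cmul0l// cmulDl. Qed.

Lemma cmul_sumr (I : Type) (s : seq I) (P : pred I) (F : I -> A) y :
  y ** (\sum_(i <- s | P i) F i) = \sum_(i <- s | P i) y ** F i.
Proof. by elim/big_rec2: _ => [|i u v _ <-]; rewrite ?cmul0r// cmulDr. Qed.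

Lemma adj0 : adj 0 = 0 :> A.
Proof. by apply: (addrI (adj 0)); rewrite -adjD !addr0. Qed.

Lemma adjN x : adj (- x) = - adj x.
Proof. by apply: (addrI (adj x)); rewrite -adjD !subrr adj0. Qed.

Lemma adjB x y : adj (x - y) = adj x - adj y.
Proof. by rewrite adjD adjN. Qed.

Lemma adjZr e x : adj (e%:C%C *: x) = e%:C%C *: adj x.
Proof. by rewrite Defs.adjZ; congr (_ *: _); apply/CrealP; rewrite complex_real. Qed.

Lemma rnormM x y : rnorm (x ** y) <= rnorm x * rnorm y.
Proof. by rewrite -lecR rmorphM/= -!normr_rnorm ler_norm_cmul. Qed.

Lemma rnorm_adjM x : rnorm (adj x ** x) = rnorm x ^+ 2.
Proof.
by apply: complexI; rewrite rmorphXn/= -!normr_rnorm norm_adj_cmul.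
Qed.

Lemma rnorm_adj x : rnorm (adj x) = rnorm x.
Proof.
suff le y : rnorm y <= rnorm (adj y).
  by apply/eqP; rewrite eq_le le -{2}(adjK x) le.
have := rnormM (adj y) y; rewrite rnorm_adjM expr2.
have [/rnorm_eq0 -> _|y0] := eqVneq (rnorm y) 0; first by rewrite rnorm0 rnorm_ge0.
by rewrite ler_pM2r// lt0r y0 rnorm_ge0.
Qed.

Lemma cmull_continuous a : continuous (fun x => a ** x).
Proof.
by apply: (@lipschitz_rnorm _ _ _ _ (rnorm a)) => x y; rewrite -cmulBr rnormM.
Qed.

Lemma cmulr_continuous a : continuous (fun x => x ** a).
Proof.
apply: (@lipschitz_rnorm _ _ _ _ (rnorm a)) => x y.
by rewrite -cmulBl mulrC rnormM.
Qed.

Lemma adj_continuous : continuous (@adj R A).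
Proof.
by apply: (@lipschitz_rnorm _ _ _ _ 1) => x y; rewrite -adjB rnorm_adj mul1r.
Qed.

(** Banach's fixed point theorem. The closed invariant set [U] carries side conditions such as
    self-adjointness and commutation over to the fixed point. *)
Lemma contraction_fixpoint (U : set A) (phi : A -> A) (q : R) (x0 : A) :
  0 <= q -> q < 1 -> closed U -> U x0 -> (forall x, U x -> U (phi x)) ->
  (forall x y, U x -> U y -> rnorm (phi x - phi y) <= q * rnorm (x - y)) ->
  exists2 x, U x & phi x = x.
Proof.
move=> q0 q1 cU U0 Uphi lip; pose u n := iter n phi x0.
have Uu n : U (u n) by elim: n => // n; exact: Uphi.
have [||l ul lu] := @geometric_cvg _ _ u (rnorm (u 1%N - u 0%N)) q _ q0 q1.
- exact: rnorm_ge0.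
- elim=> [|n IHn]; first by rewrite mulr1.
  by apply: (le_trans (lip _ _ (Uu n.+1) (Uu n))); rewrite exprS mulrCA ler_wpM2l.
have Ul : U l by exact: closed_cvg_rnorm ul.
exists l => //; apply/esym/(cvg_rnorm_unique ul).
rewrite -(cvg_shiftS u).
apply/cvg_rnormP => e e0.
apply: filterS ((cvg_rnormP _ _).1 ul e e0) => n lun.
rewrite (le_lt_trans (lip _ _ Ul (Uu n)))//.
by rewrite (@le_lt_trans _ _ (rnorm (l - u n)))// ler_piMl ?rnorm_ge0// ltW.
Qed.

(* When [a] and [y] are commuting self-adjoint elements with
   [a^2 + (1 - y)^2 = 1], the element [a + i (1 - y)] of the unitization is
   unitary, so that its real and imaginary parts are contractions. *)
Section Unitary.
Variables (a y : A).
Hypotheses (aa : adj a = a) (yy : adj y = y) (ay : a ** y = y ** a).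
Hypothesis a2 : a ** a = y + y - y ** y.

(** Left multiplication by the unitary [a + w (1 - y)], written without a unit, where [w] is ['i] or
    [- 'i]. In the expansion of the square the cross terms cancel because [a] and [y] commute, and
    [a2] reduces the rest to [adj c ** c]. *)
Lemma unitary_isometry (w : R[i]) c : Num.conj w = - w -> w * w = -1 ->
  rnorm (a ** c + w *: (c - y ** c)) = rnorm c.
Proof.
move=> cw w2; apply: (@pexpIrn _ 2); rewrite ?nnegrE ?rnorm_ge0//.
rewrite -!rnorm_adjM; congr rnorm.
rewrite adjD Defs.adjZ adjB !adjM aa yy cw cmulDl !cmulDr !cmulZl !cmulZr scalerA.
rewrite mulNr w2 opprK scale1r.
have -> : (adj c ** a) ** (a ** c) =
    adj c ** y ** c + adj c ** y ** c - adj c ** (y ** y) ** c.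
  by rewrite cmulA -(cmulA (adj c) a a) a2 cmulBr cmulDr cmulBl cmulDl.
have -> : (adj c - adj c ** y) ** (c - y ** c) =
   adj c ** c - (adj c ** y ** c + adj c ** y ** c - adj c ** (y ** y) ** c).
  by rewrite cmulBl !cmulBr !cmulA !opprD !opprK !addrA.
have -> : (adj c ** a) ** (c - y ** c) = (adj c - adj c ** y) ** (a ** c).
  by rewrite cmulBl cmulBr !cmulA -(cmulA _ a y) ay !cmulA.
by rewrite scaleNr -addrA addNKr addrC subrK.
Qed.

Lemma unitary_Re c : rnorm (a ** c) <= rnorm c.
Proof.
pose z (w : R[i]) := a ** c + w *: (c - y ** c).
(* The real part is the mean of the two conjugate unitaries, each of which is isometric. *)
have -> : a ** c = (2^-1 : R)%:C%C *: (z 'i + z (- 'i)).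
  rewrite /z scaleNr addrACA subrr addr0.
  by rewrite scale_half.
rewrite rnormZr ger0_norm ?invr_ge0// ler_pdivrMl//.
rewrite (le_trans (rnormD _ _))// /z !unitary_isometry//.
1: by rewrite mulr2n mulrDl !mul1r.
all: by rewrite ?rmorphN/= ?conjCi ?mulrNN -?expr2 ?sqrCi.
Qed.

Lemma unitary_Im c : rnorm (c - y ** c) <= rnorm c.
Proof.
pose z (w : R[i]) := a ** c + w *: (c - y ** c).
have -> : rnorm (c - y ** c) = rnorm ((2^-1 : R)%:C%C *: (z 'i - z (- 'i))).
  have -> : z 'i - z (- 'i) = 'i *: (c - y ** c) + 'i *: (c - y ** c).
    by rewrite /z scaleNr opprB [LHS]addrC addrA subrK.
  by rewrite scale_half -complexiE rnormZi.
rewrite rnormZr ger0_norm ?invr_ge0// ler_pdivrMl//.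
rewrite (le_trans (rnormB _ _))// /z !unitary_isometry//.
1: by rewrite mulr2n mulrDl !mul1r.
all: by rewrite ?rmorphN/= ?conjCi ?mulrNN -?expr2 ?sqrCi.
Qed.

(** For [c = a] the bound on left multiplication reads [|a|^2 <= |a|], by the C*-identity. *)
Lemma unitary_le1 : rnorm a <= 1.
Proof.
have := unitary_Re a; rewrite -{1}aa rnorm_adjM expr2.
have [->//|a0] := eqVneq (rnorm a) 0.
by rewrite -{3}(mul1r (rnorm a)) ler_pM2r// lt0r a0 rnorm_ge0.
Qed.

End Unitary.

(** The element [y = 1 - (1 - x^2)^(1/2)] is found as the fixed point of [y |-> (x^2 + y^2) / 2] on
    the ball of radius [|x|]. The map is Lipschitz there with constant [|x|], since
    [y^2 - z^2 = y (y - z) + (y - z) z]. *)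
Lemma sqrt_unitary x : adj x = x -> rnorm x < 1 ->
  exists y, [/\ adj y = y, x ** y = y ** x & x ** x = y + y - y ** y].
Proof.
move=> xx x1.
pose U := [set y : A | [/\ rnorm y <= rnorm x, adj y = y & x ** y = y ** x]].
pose phi y := (2^-1 : R)%:C%C *: (x ** x + y ** y).
have cU : closed U.
  apply/closed_rnormP => y yU.
  have cl (f g : A -> A) : continuous f -> continuous g ->
      (forall z, U z -> f z = g z) -> f y = g y.
    move=> cf cg fg; suff : [set z | f z = g z] y by [].
    have /closed_rnormP := closed_equalizer cf cg; apply => e /yU[z Uz yz].
    by exists z => //; exact: fg.
  split.
  - apply/ler_addgt0Pr => e /yU[z [zx _ _] yz].
    have := rnormD (y - z) z; rewrite subrK => /le_trans-> //.
    by rewrite addrC lerD// ltW.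
  - apply: (cl (@adj R A) id) => //.
    + exact: adj_continuous.
    + by move=> z; exact: cvg_id.
    + by move=> z [].
  - apply: (cl (fun z => x ** z) (fun z => z ** x)).
    + exact: cmull_continuous.
    + exact: cmulr_continuous.
    + by move=> z [].
have x0 := rnorm_ge0 x.
have xle : rnorm x * rnorm x <= rnorm x by rewrite ler_piMl// ltW.
have [|||y [_ yy xy] py] := @contraction_fixpoint U phi (rnorm x) 0 x0 x1 cU.
- by split; rewrite ?rnorm0 ?adj0 ?cmul0l ?cmul0r.
- move=> y [yx yy xy]; split.
  + rewrite rnormZr ger0_norm ?invr_ge0// ler_pdivrMl//.
    rewrite (le_trans (rnormD _ _))// mulr2n mulrDl !mul1r.
    rewrite lerD// (le_trans (rnormM _ _))// (le_trans _ xle)//.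
    by rewrite ler_pM// rnorm_ge0.
  + by rewrite adjZr adjD !adjM yy xx.
  + by rewrite cmulZl cmulZr cmulDl cmulDr !cmulA xy -!cmulA xy.
- move=> y z [yx _ _] [zx _ _].
  rewrite -scalerBr rnormZr ger0_norm ?invr_ge0// ler_pdivrMl//.
  have -> : x ** x + y ** y - (x ** x + z ** z) = y ** (y - z) + (y - z) ** z.
    by rewrite opprD addrACA subrr add0r cmulBl cmulBr addrA subrK.
  rewrite (le_trans (rnormD _ _))// mulr2n mulrDl mul1r.
  rewrite lerD// (le_trans (rnormM _ _))//; first by rewrite ler_wpM2r// rnorm_ge0.
  by rewrite mulrC ler_wpM2r// rnorm_ge0.
exists y; split=> //; have : phi y + phi y = x ** x + y ** y.
  by rewrite -scalerDr scale_half.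
by rewrite py => ->; rewrite addrK.
Qed.

(** Here [1 - x^2 = (1 - y)^2], and multiplication by [1 - y] is a contraction by [unitary_Im]. *)
Lemma square_le x c : adj x = x -> rnorm x < 1 -> rnorm (c - x ** (x ** c)) <= rnorm c.
Proof.
move=> xx /(sqrt_unitary xx)[y [yy xy x2]].
rewrite cmulA x2 cmulBl cmulDl.
have -> : c - (y ** c + y ** c - y ** y ** c) = c - y ** c - y ** (c - y ** c).
  by rewrite cmulBr cmulA !opprD !opprK !addrA.
by rewrite (le_trans (unitary_Im xx yy xy x2 _))// (unitary_Im xx yy xy x2).
Qed.

(** The rescaling of [square_le] by [M]; it replaces the spectral bound [0 <= x^2 <= M^2] in the
    construction of the resolvent. *)
Lemma square_leM x c (M : R) : adj x = x -> rnorm x < M ->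
  rnorm ((M ^+ 2)%:C%C *: c - x ** (x ** c)) <= M ^+ 2 * rnorm c.
Proof.
move=> xx xM; have M0 : 0 < M by rewrite (le_lt_trans _ xM)// rnorm_ge0.
pose x' := (M^-1)%:C%C *: x.
have x'x : adj x' = x' by rewrite adjZr xx.
have x'1 : rnorm x' < 1.
  by rewrite rnormZr ger0_norm ?invr_ge0 1?ltW// ltr_pdivrMl// mulr1.
have -> : (M ^+ 2)%:C%C *: c - x ** (x ** c) =
    (M ^+ 2)%:C%C *: (c - x' ** (x' ** c)).
  rewrite /x' scalerBr !cmulZl cmulZr !scalerA -!rmorphM/= expr2.
  by rewrite -mulrA mulVKf ?gt_eqF// mulfV ?gt_eqF// scale1r.
by rewrite rnormZr ger0_norm ?sqr_ge0// ler_wpM2l ?sqr_ge0// square_le.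
Qed.

Lemma commutation_closed x : closed [set w : A | adj w = w /\ x ** w = w ** x].
Proof.
apply: closedI; apply: closed_equalizer.
- exact: adj_continuous.
- by move=> w; exact: cvg_id.
- exact: cmull_continuous.
- exact: cmulr_continuous.
Qed.

(* [w = x (1 + x^2)^-1], so that [2 w + i (1 - 2 x w)] is unitary. *)
Lemma resolvent x : adj x = x -> exists w,
  [/\ adj w = w, w + x ** (x ** w) = x & rnorm w <= 2^-1].
Proof.
(* The equation [(1 + x^2) w = x] is equivalent to [w = k (x + (M^2 - x^2) w)], whose right side
   contracts with factor [k M^2 = 1 - k < 1]. The summand 1 in [M] gives the strict inequality
   [|x| < M]. *)
move=> xx; pose M := rnorm x + 1; pose k := (1 + M ^+ 2)^-1.
have M0 : 0 <= M by rewrite addr_ge0// rnorm_ge0.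
have k0 : 0 < k by rewrite invr_gt0 ltr_wpDr// sqr_ge0.
have kM : 1 - k = k * M ^+ 2.
  by rewrite /k; field; rewrite gt_eqF// ltr_wpDr// sqr_ge0.
pose U := [set w : A | adj w = w /\ x ** w = w ** x].
pose phi w := k%:C%C *: (x + ((M ^+ 2)%:C%C *: w - x ** (x ** w))).
have [||||||w [ww xw] pw] := @contraction_fixpoint U phi (1 - k) 0.
- by rewrite kM mulr_ge0// ?sqr_ge0// ltW.
- by rewrite gtrBl.
- exact: commutation_closed.
- by split; rewrite ?adj0 ?cmul0l ?cmul0r.
- move=> w [ww xw]; split.
    by rewrite adjZr adjD adjB adjZr !adjM xx ww -xw -cmulA -xw.
  rewrite cmulZl cmulZr cmulDl cmulDr cmulBl cmulBr cmulZl cmulZr xw.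
  by rewrite -(cmulA x _ x) -xw -(cmulA x w x) -xw.
- move=> w z _ _; rewrite -scalerBr rnormZr gtr0_norm// kM -mulrA ler_pM2l//.
  rewrite [X in rnorm X](_ : _ = (M ^+ 2)%:C%C *: (w - z) - x ** (x ** (w - z))).
    by rewrite square_leM// ltrDl.
  by rewrite scalerBr !cmulBr opprD addrACA subrr add0r !opprD !opprK addrACA.
have xw2 : w + x ** (x ** w) = x.
  apply: (addIr ((M ^+ 2)%:C%C *: w - x ** (x ** w))).
  have -> : x + ((M ^+ 2)%:C%C *: w - x ** (x ** w)) = (1 + M ^+ 2)%:C%C *: phi w.
    rewrite scalerA -rmorphM/= /k mulfV ?scale1r// gt_eqF//.
    by rewrite ltr_wpDr// sqr_ge0.
  rewrite pw rmorphD/= scalerDl scale1r -addrA; congr (_ + _).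
  by rewrite addrC subrK.
(* Multiplying [w = x - x^2 w] by [w] gives [w^2 = x w - (x w)^2], which is
   [(2 w)^2 + (1 - 2 x w)^2 = 1]. *)
have w2 : w ** w = x ** w - x ** w ** (x ** w).
  rewrite -[X in X ** w](addrK (x ** (x ** w))) xw2 cmulBl !cmulA.
  by rewrite -(cmulA x w x) -xw !cmulA.
exists w; split=> //.
rewrite -[X in rnorm X]scale_half rnormZr ger0_norm ?invr_ge0//.
rewrite -{2}(mulr1 2^-1) ler_wpM2l ?invr_ge0//.
apply: (@unitary_le1 _ (x ** w + x ** w)).
- by rewrite adjD ww.
- by rewrite adjD adjM ww xx xw.
- by rewrite !cmulDl !cmulDr !cmulA -xw.
- rewrite !cmulDl !cmulDr w2.
  set p := x ** w; set q := p ** p.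
  by rewrite (addrACA p) (addrACA (p + p)) -!opprD.
Qed.

End CStarTheory.

(** * Closed subspaces and density of the span of generators *)

Definition closed_subspace (R : realType) (V : completeNormedModType R[i]) (W : set V) :=
  [/\ closed W, W 0 & forall (r : R[i]) x y, W x -> W y -> W (r *: x + y)].

Section ClosedSubspace.
Context {R : realType} {V : completeNormedModType R[i]} (W : set V).
Hypothesis Wsub : closed_subspace W.

Lemma closed_subspaceD x y : W x -> W y -> W (x + y).
Proof. by case: Wsub => _ _ WD Wx Wy; rewrite -(scale1r x); exact: WD. Qed.

Lemma closed_subspaceZ (r : R[i]) x : W x -> W (r *: x).
Proof. by case: Wsub => _ W0 WD Wx; rewrite -(addr0 (r *: x)); exact: WD. Qed.

Lemma closed_subspaceN x : W x -> W (- x).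
Proof. by rewrite -scaleN1r; exact: closed_subspaceZ. Qed.

Lemma closed_subspace_sum (I : Type) (s : seq I) (P : pred I) (F : I -> V) :
  (forall i, P i -> W (F i)) -> W (\sum_(i <- s | P i) F i).
Proof.
move=> WF; case: Wsub => _ W0 _; elim/big_ind: _ => //.
exact: closed_subspaceD.
Qed.

End ClosedSubspace.

Lemma closed_subspace_preimage (R : realType) (V U : completeNormedModType R[i])
  (f : V -> U) (W : set U) : continuous f ->
  (forall (r : R[i]) x y, f (r *: x + y) = r *: f x + f y) ->
  closed_subspace W -> closed_subspace [set x | W (f x)].
Proof.
move=> cf fL [cW W0 WD]; split.
- exact: closed_preimage.
- rewrite /=; suff -> : f 0 = 0 by [].
  by apply: (addrI (f 0)); rewrite -[X in X + _]scale1r -fL scale1r !addr0.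
- by move=> r x y /= Wx Wy; rewrite fL; exact: WD.
Qed.

(** If products of generators stay in the closed span [W0] of [G], then [W0] is already a closed
    star-subalgebra, hence everything. Statements that define closed subspaces may thus be checked
    on generators. *)
Lemma generated_dense (R : realType) (A : cstarType R) (G W : set A) :
  generated_by G -> (forall x, G x -> G (adj x)) ->
  (forall x y D, G x -> G y -> closed_subspace D -> G `<=` D -> D (x ** y)) ->
  closed_subspace W -> G `<=` W -> W = setT.
Proof.
move=> gG Gadj GM Wsub GW.
pose W0 := \bigcap_(D in [set D : set A | closed_subspace D /\ G `<=` D]) D.
have GW0 : G `<=` W0 by move=> x Gx D [_]; exact.
have W0sub : closed_subspace W0.
  split.
  - by apply: closed_bigI => D [[]].
  - by move=> D [[]].
  - by move=> r x y W0x W0y D DP; have [[_ _ +] _] := DP; apply; [exact: W0x|exact: W0y].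
have W0min D : closed_subspace D -> G `<=` D -> W0 `<=` D.
  by move=> Dsub GD x; apply; split.
have W0T : W0 = setT.
  apply: gG => //; split; try by case: W0sub.
  (* Products are treated one factor at a time: first a generator on the left, then an arbitrary
     left factor with the right one fixed. *)
  - have step1 x y : G x -> W0 y -> W0 (x ** y).
      move=> Gx; move: y; apply: W0min => [|y Gy].
        apply: closed_subspace_preimage W0sub; first exact: cmull_continuous.
        by move=> r y z; rewrite cmulDr cmulZr.
      exact: GM.
    move=> x y W0x W0y; move: x W0x; apply: W0min => [|x Gx]; last exact: step1.
    apply: closed_subspace_preimage W0sub; first exact: cmulr_continuous.
    by move=> r x z; rewrite cmulDl cmulZl.
  - apply: W0min => [|x Gx]; last by apply: GW0; exact: Gadj.
    split.
    + by apply: closed_preimage; [exact: adj_continuous | case: W0sub].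
    + by rewrite /= adj0; case: W0sub.
    + move=> r x y /=; rewrite adjD Defs.adjZ; case: W0sub => _ _; exact.
by apply/seteqP; split=> // x _; apply: (W0min _ Wsub GW); rewrite W0T.
Qed.

(** * Contractivity and closed range of *-homomorphisms *)

Section StarHom.
Context {R : realType} {A B : cstarType R} (f : {linear B -> A}).
Hypothesis fhom : star_hom f.

Let fM x y : f (x ** y) = f x ** f y. Proof. exact: fhom.1. Qed.
Let fadj x : f (adj x) = adj (f x). Proof. exact: fhom.2. Qed.

(** The relations of [sqrt_unitary] are preserved by [f], which bounds [f] on self-adjoint elements
    of norm below 1. Scaling gives all self-adjoint elements, and the C*-identity for [adj x ** x]
    the general case. *)
Lemma star_hom_contractive x : rnorm (f x) <= rnorm x.
Proof.
have sa1 y : adj y = y -> rnorm y < 1 -> rnorm (f y) <= 1.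
  move=> yy /(sqrt_unitary yy)[z [zz yz y2]].
  apply: (@unitary_le1 _ _ _ (f z)); rewrite -?fadj -?fM ?yy ?zz ?yz//.
  by rewrite y2 linearB linearD.
have sa y : adj y = y -> rnorm (f y) <= rnorm y.
  move=> yy; apply/ler_addgt0Pr => e e0.
  have ye : 0 < rnorm y + e by rewrite ltr_wpDl// rnorm_ge0.
  pose z := ((rnorm y + e)^-1)%:C%C *: y.
  have := sa1 z; rewrite adjZr yy linearZ !rnormZr gtr0_norm ?invr_gt0//.
  rewrite ltr_pdivrMl// mulr1 ltrDl ler_pdivrMl// mulr1.
  exact.
rewrite -(@ler_pXn2r _ 2) ?nnegrE ?rnorm_ge0//.
by rewrite -!rnorm_adjM -fadj -fM sa// adjM adjK.
Qed.

Lemma star_hom_continuous : continuous f.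
Proof.
apply: (@lipschitz_rnorm _ _ _ _ 1) => x y.
by rewrite mul1r -linearB star_hom_contractive.
Qed.

Let approximable (y : A) := forall e : R, 0 < e -> exists x, rnorm (y - f x) < e.

(** An approximate preimage comes without a norm bound. Replacing it by [w = x1 (1 + x1^2)^-1]
    forces norm at most 1/2, at the price of an error that is still a fixed fraction of [C]. *)
Let half_lift y (C : R) : 0 < C -> adj y = y -> approximable y -> rnorm y <= C ->
  exists x, [/\ adj x = x, rnorm x <= C & rnorm (y - f x) <= C * (3 / 4)].
Proof.
move=> C0; wlog -> : y C C0 / C = 1 => [wlg yy ya yC|yy ya y1].
  have [|||||x [xx x1 xy]] := wlg ((C^-1)%:C%C *: y) 1 => //.
  - by rewrite adjZr yy.
  - move=> e e0; have [x yx] := ya _ (mulr_gt0 C0 e0).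
    exists ((C^-1)%:C%C *: x); rewrite linearZ -scalerBr rnormZr.
    by rewrite gtr0_norm ?invr_gt0// ltr_pdivrMl.
  - by rewrite rnormZr gtr0_norm ?invr_gt0// ler_pdivrMl// mulr1.
  exists (C%:C%C *: x); split.
  - by rewrite adjZr xx.
  - by rewrite rnormZr gtr0_norm// ler_piMr// ltW.
  - move: xy; rewrite mul1r -(ler_pM2l C0) -{1}(gtr0_norm C0) -rnormZr.
    rewrite scalerBr scalerA -rmorphM/= mulfV ?gt_eqF//.
    by rewrite scale1r -(linearZZ f).
(* With tolerance 1/10 the total error is at most [1/10 + (11/10)^2 / 2 = 0.705], below 3/4; the
   second term bounds [f x1 - f w = f x1 ** (f x1 ** f w)]. *)
have [|x0 yx0] := ya (10%:R^-1); first by rewrite invr_gt0.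
pose x1 := (2^-1 : R)%:C%C *: (x0 + adj x0).
have x1x : adj x1 = x1 by rewrite adjZr adjD adjK addrC.
have yx1 : rnorm (y - f x1) <= 10%:R^-1.
  have -> : y - f x1 = (2^-1 : R)%:C%C *: ((y - f x0) + adj (y - f x0)).
    rewrite adjB yy -fadj linearZ linearD addrACA -opprD scalerBr.
    by rewrite scale_half.
  rewrite rnormZr ger0_norm ?invr_ge0// ler_pdivrMl//.
  by rewrite (le_trans (rnormD _ _))// rnorm_adj mulr2n mulrDl mul1r lerD// ltW.
have [w [ww xw w1]] := resolvent x1x.
exists w; split=> //; first by rewrite (le_trans w1)// invf_le1// ler1n.
have fx1 : rnorm (f x1) <= 11%:R / 10%:R.
  have := rnormB y (y - f x1); rewrite opprB addrC subrK => /le_trans -> //.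
  by have := lerD y1 yx1; lra.
rewrite (le_trans (rnorm_dist _ (f x1) _))//.
rewrite -{2}xw linearD (addrC (f w)) addrK !fM.
have fw : rnorm (f w) <= 2^-1 by rewrite (le_trans (star_hom_contractive _)).
have : rnorm (f x1 ** (f x1 ** f w)) <= 11%:R / 10%:R * (11%:R / 10%:R * 2^-1).
  rewrite (le_trans (rnormM _ _))// ler_pM ?rnorm_ge0//.
  by rewrite (le_trans (rnormM _ _))// ler_pM ?rnorm_ge0.
by move: yx1; lra.
Qed.

Lemma star_hom_closed_range : closed (range f).
Proof.
have sa y : adj y = y -> approximable y -> range f y.
  move=> yy ya; pose C := rnorm y + 1.
  have C0 : 0 < C by rewrite ltr_wpDl// rnorm_ge0.
  have q0 : 0 <= 3 / 4 :> R by rewrite divr_ge0.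
  have q1 : 3 / 4 < 1 :> R by lra.
  (* The invariants are premises under the existential, so that [choice] yields a total step
     function; a step lifts the remaining error [y - f s] by [half_lift]. *)
  have next (ns : nat * B) : exists s', adj ns.2 = ns.2 ->
      rnorm (y - f ns.2) <= C * (3 / 4) ^+ ns.1 ->
      [/\ adj s' = s', rnorm (y - f s') <= C * (3 / 4) ^+ ns.1.+1 &
         rnorm (s' - ns.2) <= C * (3 / 4) ^+ ns.1].
    case: ns => n s /=.
    have [[ss sC]|nP] := pselect (adj s = s /\ rnorm (y - f s) <= C * (3 / 4) ^+ n);
      last by exists 0 => ss sC; exfalso; exact: nP.
    have [|||x [xx x1 x2]] := @half_lift (y - f s) (C * (3 / 4) ^+ n) _ _ _ sC.
    - by rewrite mulr_gt0// exprn_gt0//; lra.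
    - by rewrite adjB yy -fadj ss.
    - move=> e /ya[x yx]; exists (x - s); rewrite linearB.
      by rewrite opprB addrA subrK.
    exists (s + x) => _ _; split.
    - by rewrite adjD ss xx.
    - by rewrite linearD opprD addrA exprSr (mulrA C).
    - by rewrite addrAC subrr add0r.
  have [g gP] := choice next.
  pose u := fix u n := if n is m.+1 then g (m, u m) else 0.
  have uP n : adj (u n) = u n /\ rnorm (y - f (u n)) <= C * (3 / 4) ^+ n.
    elim: n => [|n [un uC]].
      by rewrite adj0 linear0 subr0 mulr1 lerDl.
    by have [] := gP (n, u n) un uC.
  have [||l ul lu] := @geometric_cvg _ _ u C (3 / 4) _ q0 q1.
  - exact: ltW.
  - by move=> n; have [un uC] := uP n; have [] := gP (n, u n) un uC.
  exists l => //; have fl : f (u n) @[n --> \oo] --> f l.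
    by apply: continuous_cvg ul; exact: star_hom_continuous.
  apply: cvg_rnorm_unique fl _; apply/cvg_rnormP => e e0.
  have : geometric C (3 / 4) n @[n --> \oo] --> (0 : R).
    by apply: cvg_geometric; rewrite ger0_norm.
  move=> /cvgrPdist_lt/(_ e e0); apply: filterS => n.
  rewrite sub0r normrN /= => /ltr_normlW; apply: le_lt_trans; exact: (uP n).2.
have adjc z : approximable z -> approximable (adj z).
  move=> za e /za[x zx]; exists (adj x); by rewrite fadj -adjB rnorm_adj.
have sum z z' : approximable z -> approximable z' -> approximable (z + z').
  move=> za z'a e e0; have e2 : 0 < e / 2 by rewrite divr_gt0.
  have [x zx] := za _ e2; have [x' zx'] := z'a _ e2.
  exists (x + x'); rewrite linearD opprD addrACA (splitr e).
  by rewrite (le_lt_trans (rnormD _ _))// ltrD.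
have ima z : approximable z -> approximable ('i%C *: z).
  move=> za e /za[x zx]; exists ('i%C *: x).
  by rewrite linearZ -scalerBr rnormZi.
have opp z : approximable z -> approximable (- z).
  by move=> za e /za[x zx]; exists (- x); rewrite linearN -opprD rnormN.
apply/closed_rnormP => y yD.
have ya : approximable y by move=> e /yD[_ [x _ <-]]; exists x.
(* Both elements are self-adjoint and in the closure of the range, and [y] is half of
   [y1 - i y2]. *)
pose y1 := y + adj y; pose y2 := 'i%C *: (y - adj y).
have [||x1 _ x1y] := sa y1; first by rewrite adjD adjK addrC.
  by apply: sum => //; exact: adjc.
have [||x2 _ x2y] := sa y2.
- by rewrite Defs.adjZ complexiE conjCi adjB adjK scaleNr -scalerN opprB -complexiE.
- by apply/ima/sum => //; exact/opp/adjc.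
exists ((2^-1 : R)%:C%C *: (x1 - 'i%C *: x2)) => //.
rewrite (linearZZ f) linearB (linearZZ f) x1y x2y /y1 /y2 scalerA complexiE -expr2 sqrCi.
by rewrite scaleN1r opprK addrACA subrr addr0 scale_half.
Qed.

End StarHom.

(** * Operators on l2 *)

Section SquareSummable.
Context {R : realType} {I : choiceType}.
Implicit Types (x y : I -> R[i]) (F G : {fset I}).

(** The real part of [z * Num.conj w]. *)
Definition rdot (z w : R[i]) : R :=
  complex.Re z * complex.Re w + complex.Im z * complex.Im w.

Lemma rdotC z w : rdot z w = rdot w z.
Proof. by rewrite /rdot; ring. Qed.

Lemma rdotDl z1 z2 w : rdot (z1 + z2) w = rdot z1 w + rdot z2 w.
Proof. by case: z1 z2 => [a b] [c d]; rewrite /rdot/=; ring. Qed.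

Lemma rdotZ a z w : rdot (a * z) w = rdot z (Num.conj a * w).
Proof. by case: a z w => [a b] [c d] [e f]; rewrite /rdot/=; ring. Qed.

Lemma rdot_ge0 z : 0 <= rdot z z.
Proof. by rewrite addr_ge0// -expr2 sqr_ge0. Qed.

Lemma rdot_eq0 z : rdot z z = 0 -> z = 0.
Proof.
case: z => a b /eqP; rewrite /rdot/= -!expr2 paddr_eq0 ?sqr_ge0// !sqrf_eq0.
by case/andP => /eqP -> /eqP ->.
Qed.

Lemma rdot_scale a z : rdot (a * z) (a * z) = rdot a a * rdot z z.
Proof. by case: a z => [a b] [c d]; rewrite /rdot/=; ring. Qed.

Lemma rdot_parallelogram z w :
  rdot (z + w) (z + w) + rdot (z - w) (z - w) = 2 * (rdot z z + rdot w w).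
Proof. by case: z w => [a b] [c d]; rewrite /rdot/=; ring. Qed.

Lemma rdot_polarization z w :
  rdot z w = 4^-1 * (rdot (z + w) (z + w) - rdot (z - w) (z - w)).
Proof. by case: z w => [a b] [c d]; rewrite /rdot/=; field. Qed.

Definition square_summable x : Prop :=
  exists K : R, forall F, \sum_(i <- F) rdot (x i) (x i) <= K.

Definition square_summable_pred : pred (I -> R[i]) :=
  [pred x | `[< square_summable x >]].

Lemma square_summable_closed : subsemimod_closed square_summable_pred.
Proof.
split; [split|].
- by apply/asboolP; exists 0 => F; rewrite big1// => i _; rewrite /rdot/= !mul0r addr0.
- move=> x y /asboolP[K xK] /asboolP[K' yK']; apply/asboolP.
  exists (2 * (K + K')) => F.
  rewrite (@le_trans _ _ (2 * (\sum_(i <- F) rdot (x i) (x i)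
    + \sum_(i <- F) rdot (y i) (y i))))//; last by rewrite ler_pM2l// lerD.
  rewrite -big_split/= mulr_sumr ler_sum// => i _.
  by rewrite -rdot_parallelogram lerDl rdot_ge0.
- move=> a x /asboolP[K xK]; apply/asboolP; exists (rdot a a * K) => F.
  under eq_bigr do rewrite rdot_scale.
  by rewrite -mulr_sumr ler_wpM2l// rdot_ge0.
Qed.

HB.instance Definition _ :=
  GRing.isSubmodClosed.Build R[i] (I -> R[i]) square_summable_pred square_summable_closed.

Record l2 := L2 { l2val :> I -> R[i]; l2valP : l2val \in square_summable_pred }.

HB.instance Definition _ := [isSub for l2val].
HB.instance Definition _ := [Choice of l2 by <:].
HB.instance Definition _ := [SubChoice_isSubLmodule of l2 by <:].

Lemma l2E (x y : l2) : (forall i, x i = y i) -> x = y.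
Proof. by move=> xy; apply/val_inj/funext. Qed.

Lemma l2D (x y : l2) i : (x + y) i = x i + y i. Proof. by []. Qed.
Lemma l2Z a (x : l2) i : (a *: x) i = a * x i. Proof. by []. Qed.
Definition fset_sum (f : I -> R) F : R := \sum_(i <- F) f i.

Lemma ler_sum_fset (f : I -> R) F G : (forall i, 0 <= f i) -> (F `<=` G)%fset ->
  \sum_(i <- F) f i <= \sum_(i <- G) f i.
Proof.
move=> f0 FG; pose g i := if i \in F then f i else 0.
have -> : \sum_(i <- F) f i = \sum_(i <- F) g i.
  by rewrite big_seq [RHS]big_seq; apply: eq_bigr => i iF; rewrite /g iF.
rewrite (big_fset_incl _ FG) => [|i _ iF].
  by apply: ler_sum => i _; rewrite /g; case: ifP.
by rewrite /g (negbTE iF).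
Qed.

Lemma sum_fset_cvg (f : I -> R) (K : R) : (forall i, 0 <= f i) ->
  (forall F, \sum_(i <- F) f i <= K) -> cvg (fset_sum f @ totally).
Proof.
move=> f0 fK; pose S := [set \sum_(i <- F) f i | F in [set: {fset I}]].
have hS : has_sup S.
  split; first by exists (\sum_(i <- fset0) f i), fset0.
  by exists K => _ [F _ <-].
apply/cvg_ex; exists (sup S); apply/cvgrPdist_lt => e e0.
have [_ [F _ <-] Fe] := sup_adherent e0 hS.
exists F => // G /= FG; rewrite ger0_norm.
  by rewrite ltrBlDr -ltrBlDl (lt_le_trans Fe)// ler_sum_fset.
by rewrite subr_ge0; apply: ub_le_sup; [exact: hS.2 | exists G].
Qed.

(** Polarization turns the series into a difference of two series with nonnegative terms, which
    converge because their partial sums are bounded. *)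
Lemma sum_rdot_cvg (x y : l2) :
  cvg (fset_sum (fun i => rdot (x i) (y i)) @ totally).
Proof.
have sq (z : l2) : cvg (fset_sum (fun i => rdot (z i) (z i)) @ totally).
  have /asboolP[K zK] := l2valP z.
  by apply: sum_fset_cvg zK => i; exact: rdot_ge0.
have -> : fset_sum (fun i => rdot (x i) (y i)) = (fun F : {fset I} => 4^-1 *
   (\sum_(i <- F) rdot ((x + y) i) ((x + y) i) -
    \sum_(i <- F) rdot ((x - y) i) ((x - y) i))).
  apply/funext => F; rewrite -sumrB mulr_sumr; apply: eq_bigr => i _.
  by rewrite rdot_polarization.
by apply: is_cvgM; [exact: is_cvg_cst | apply: is_cvgB; exact: sq].
Qed.

(* The real part of the inner product, so that only real series occur; adjoints
   of complex linear maps are the same for both. *)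
Definition inner (x y : l2) : R := lim (fset_sum (fun i => rdot (x i) (y i)) @ totally).

Lemma innerP (x y : l2) : fset_sum (fun i => rdot (x i) (y i)) @ totally --> inner x y.
Proof. exact: sum_rdot_cvg. Qed.

Arguments innerP : clear implicits.

Lemma innerC (x y : l2) : inner x y = inner y x.
Proof.
rewrite /inner (_ : (fun i => rdot (x i) (y i)) = (fun i => rdot (y i) (x i)))//.
by apply/funext => i; rewrite rdotC.
Qed.

Lemma innerDl (x y z : l2) : inner (x + y) z = inner x z + inner y z.
Proof.
apply: cvg_lim => //; rewrite (_ : fset_sum _ = (fun F : {fset I} =>
  \sum_(i <- F) rdot (x i) (z i) + \sum_(i <- F) rdot (y i) (z i))).
  by apply: cvgD; exact: innerP.
by apply/funext => F; rewrite -big_split; apply: eq_bigr => i _; rewrite l2D rdotDl.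
Qed.

Lemma innerZ a (x y : l2) : inner (a *: x) y = inner x (Num.conj a *: y).
Proof.
rewrite /inner (_ : (fun i => rdot ((a *: x) i) (y i)) =
  (fun i => rdot (x i) ((Num.conj a *: y) i)))//.
by apply/funext => i; rewrite l2Z rdotZ.
Qed.

Lemma innerZl (a : R[i]) (x y : l2) : inner x (a *: y) = inner (Num.conj a *: x) y.
Proof. by rewrite innerZ conjCK. Qed.

Lemma inner0l (y : l2) : inner 0 y = 0.
Proof. by apply: (addrI (inner 0 y)); rewrite -innerDl !addr0. Qed.

Lemma innerNl (x y : l2) : inner (- x) y = - inner x y.
Proof. by apply: (addrI (inner x y)); rewrite -innerDl !subrr inner0l. Qed.

Lemma innerDr (x y z : l2) : inner z (x + y) = inner z x + inner z y.
Proof. by rewrite innerC innerDl !(innerC z). Qed.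

Lemma innerNr (x y : l2) : inner y (- x) = - inner y x.
Proof. by rewrite innerC innerNl innerC. Qed.

Lemma innerZr (e : R) (x y : l2) : inner (e%:C%C *: x) y = e * inner x y.
Proof.
apply: cvg_lim => //; rewrite (_ : fset_sum _ = (fun F : {fset I} =>
  e * \sum_(i <- F) rdot (x i) (y i))).
  by apply: cvgM; [exact: cvg_cst | exact: innerP].
apply/funext => F; rewrite mulr_sumr; apply: eq_bigr => i _; rewrite l2Z.
by case: (x i) (y i) => [a b] [c d]; rewrite /rdot/=; ring.
Qed.

Lemma sum_le_inner (x : l2) F : \sum_(i <- F) rdot (x i) (x i) <= inner x x.
Proof.
apply: (cvgr_to_ge (innerP x x)); exists F => // G /= FG.
by apply: ler_sum_fset => // i; exact: rdot_ge0.
Qed.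

Lemma inner_le (x : l2) (K : R) : (forall F, \sum_(i <- F) rdot (x i) (x i) <= K) ->
  inner x x <= K.
Proof. by move=> xK; apply: (cvgr_to_le (innerP x x)); apply: nearW. Qed.

Lemma inner_ge0 (x : l2) : 0 <= inner x x.
Proof. by rewrite (le_trans _ (sum_le_inner x fset0))// big_seq_fset0. Qed.

Lemma rdot_le_inner (x : l2) i : rdot (x i) (x i) <= inner x x.
Proof. by rewrite (le_trans _ (sum_le_inner x [fset i]%fset))// big_seq_fset1. Qed.

Lemma inner_eq0 (x : l2) : inner x x = 0 -> x = 0.
Proof.
move=> x0; apply: l2E => i; apply: rdot_eq0; apply/eqP.
by rewrite eq_le rdot_ge0 andbT -x0 rdot_le_inner.
Qed.

Lemma inner_ext (x y : l2) : (forall z, inner z x = inner z y) -> x = y.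
Proof.
by move=> xy; apply/subr0_eq/inner_eq0; rewrite innerDr innerNr xy subrr.
Qed.

Definition nrm (x : l2) : R := Num.sqrt (inner x x).

Lemma nrm_ge0 (x : l2) : 0 <= nrm x. Proof. exact: sqrtr_ge0. Qed.

Lemma nrm2 (x : l2) : nrm x ^+ 2 = inner x x.
Proof. by rewrite sqr_sqrtr// inner_ge0. Qed.

Lemma nrm_eq0 (x : l2) : nrm x = 0 -> x = 0.
Proof. by move=> x0; apply: inner_eq0; rewrite -nrm2 x0 expr0n. Qed.

Lemma nrm_le (x : l2) (K : R) : 0 <= K -> inner x x <= K ^+ 2 -> nrm x <= K.
Proof. by move=> K0; rewrite -nrm2 ler_pXn2r// nnegrE// nrm_ge0. Qed.

Lemma cauchy_schwarz (x y : l2) : inner x y <= nrm x * nrm y.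
Proof.
have [/nrm_eq0 ->|y0] := eqVneq (nrm y) 0.
  by rewrite innerC inner0l mulr_ge0// nrm_ge0.
have {}y0 : 0 < nrm y by rewrite lt0r y0 nrm_ge0.
have [/nrm_eq0 ->|x0] := eqVneq (nrm x) 0.
  by rewrite inner0l mulr_ge0// nrm_ge0.
have {}x0 : 0 < nrm x by rewrite lt0r x0 nrm_ge0.
(* The square of the norm of [z] is [2 |x| |y| (|x| |y| - inner x y)]. *)
pose z := (nrm y)%:C%C *: x - (nrm x)%:C%C *: y.
have := inner_ge0 z; rewrite /z innerDl innerNl !innerZr !innerDr !innerNr.
rewrite !(innerC _ (_ *: _)) !innerZr -!nrm2 (innerC y x).
rewrite (_ : _ - _ = 2 * (nrm x * nrm y) * (nrm x * nrm y - inner x y)).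
  by rewrite pmulr_rge0 ?subr_ge0// mulr_gt0// mulr_gt0.
by ring.
Qed.

Lemma nrmZ (a : R[i]) (x : l2) : nrm (a *: x) = complex.Re `|a| * nrm x.
Proof.
have na : (complex.Re `|a|)%:C%C = `|a| by rewrite RRe_real// ger0_real.
have a0 : 0 <= complex.Re `|a| by rewrite -ler0c na.
have aa : Num.conj a * a = (complex.Re `|a| ^+ 2)%:C%C.
  by rewrite rmorphXn /= na normCKC.
rewrite /nrm innerZ scalerA aa innerC innerZr.
by rewrite sqrtrM ?sqr_ge0// sqrtr_sqr ger0_norm.
Qed.

Lemma nrmN (x : l2) : nrm (- x) = nrm x.
Proof. by rewrite /nrm innerNl innerNr opprK. Qed.

Lemma nrmD (x y : l2) : nrm (x + y) <= nrm x + nrm y.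
Proof.
apply: nrm_le; first by rewrite addr_ge0// nrm_ge0.
rewrite innerDl !innerDr (innerC y x) sqrrD !nrm2.
by have := cauchy_schwarz x y; lra.
Qed.

Lemma nrm0 : nrm 0 = 0.
Proof. by rewrite /nrm inner0l sqrtr0. Qed.

End SquareSummable.
Arguments l2 : clear implicits.

(** * The C*-algebra of bounded adjointable operators *)

Section Operators.
Context {R : realType} {I : choiceType}.
Local Notation H := (l2 R I).
Implicit Types (a b : R[i]) (x y : H) (S : H -> H).

Definition is_adjoint S S' := forall x y, inner (S x) y = inner x (S' y).

Definition bounded_by (K : R) S := 0 <= K /\ forall x, nrm (S x) <= K * nrm x.

(** The adjoint is only asked to be a function; [adjop_exists] shows that it is again linear and
    bounded. *)
Definition adjointable S : Prop :=
  [/\ forall (a : R[i]) x y, S (a *: x + y) = a *: S x + S y,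
      exists S', is_adjoint S S' & exists K, bounded_by K S].

Definition adjointable_pred : pred (H -> H) := [pred S | `[< adjointable S >]].

Lemma adjointable_closed : subsemimod_closed adjointable_pred.
Proof.
split; [split|].
- apply/asboolP; split; [|exists (fun=> 0)|exists 0].
  + by move=> a x y; rewrite scaler0 addr0.
  + by move=> x y; rewrite -[LHS]/(inner 0 y) inner0l -[RHS]/(inner x 0) innerC inner0l.
  + by split=> // x; rewrite nrm0 mul0r.
- move=> S T /asboolP[SL [S' SS'] [K [K0 SK]]] /asboolP[TL [T' TT'] [M [M0 TM]]].
  apply/asboolP; split; [|exists (S' \+ T')|exists (K + M)].
  + by move=> a x y; rewrite !fctE SL TL scalerDr addrACA.
  + by move=> x y; rewrite !fctE innerDl innerDr SS' TT'.
  + split=> [|x]; first exact: addr_ge0.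
    by rewrite !fctE (le_trans (nrmD _ _))// mulrDl lerD.
- move=> a S /asboolP[SL [S' SS'] [K [K0 SK]]].
  have a0 : 0 <= complex.Re `|a| by rewrite -ler0c RRe_real ?ger0_real.
  apply/asboolP; split; [|exists (fun y => S' (Num.conj a *: y))|].
  + by move=> b x y; rewrite !fctE SL scalerDr !scalerA mulrC.
  + by move=> x y; rewrite !fctE innerZ SS'.
  + exists (complex.Re `|a| * K); split=> [|x]; first exact: mulr_ge0.
    by rewrite !fctE nrmZ -mulrA ler_wpM2l.
Qed.

HB.instance Definition _ :=
  GRing.isSubmodClosed.Build R[i] (H -> H) adjointable_pred adjointable_closed.

Record operator := Operator { opval :> H -> H; opvalP : opval \in adjointable_pred }.

HB.instance Definition _ := [isSub for opval].
HB.instance Definition _ := [Choice of operator by <:].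
HB.instance Definition _ := [SubChoice_isSubLmodule of operator by <:].

Implicit Types A B C : operator.

Lemma opE A B : (forall x, A x = B x) -> A = B.
Proof. by move=> AB; apply/val_inj/funext. Qed.

Lemma opD A B x : (A + B) x = A x + B x. Proof. by []. Qed.
Lemma opZ a A x : (a *: A) x = a *: A x. Proof. by []. Qed.
Lemma opL A (a : R[i]) x y : A (a *: x + y) = a *: A x + A y.
Proof. by have /asboolP[] := opvalP A. Qed.

Lemma opxD A x y : A (x + y) = A x + A y.
Proof. by rewrite -[in LHS](scale1r x) opL scale1r. Qed.

Lemma opx0 A : A 0 = 0.
Proof. by apply: (addrI (A 0)); rewrite -opxD !addr0. Qed.

Lemma opxZ A a x : A (a *: x) = a *: A x.
Proof. by rewrite -[in LHS](addr0 (a *: x)) opL opx0 addr0. Qed.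

Definition opnorm A : R := inf [set K | bounded_by K A].

Lemma opnorm_has_inf A : has_inf [set K | bounded_by K A].
Proof.
split; first by have /asboolP[_ _ [K]] := opvalP A; exists K.
by exists 0 => K [].
Qed.

Lemma opnorm_ge0 A : 0 <= opnorm A.
Proof.
by apply: lb_le_inf; [exact: (opnorm_has_inf A).1 | move=> K []].
Qed.

Lemma opnorm_le A K : bounded_by K A -> opnorm A <= K.
Proof. by apply: ge_inf; exact: (opnorm_has_inf A).2. Qed.

Lemma nrm_op A x : nrm (A x) <= opnorm A * nrm x.
Proof.
have [/nrm_eq0 ->|x0] := eqVneq (nrm x) 0; first by rewrite opx0 nrm0 mulr0.
have {}x0 : 0 < nrm x by rewrite lt0r x0 nrm_ge0.
rewrite -ler_pdivrMr//; apply: lb_le_inf; first exact: (opnorm_has_inf A).1.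
by move=> K [K0 AK]; rewrite ler_pdivrMr.
Qed.

Lemma opnormD A B : opnorm (A + B) <= opnorm A + opnorm B.
Proof.
apply: opnorm_le; split=> [|x]; first by rewrite addr_ge0// opnorm_ge0.
by rewrite opD (le_trans (nrmD _ _))// mulrDl lerD// nrm_op.
Qed.

Lemma opnorm_eq0 A : opnorm A = 0 -> A = 0.
Proof.
move=> A0; apply: opE => x; apply: nrm_eq0; apply/eqP.
by rewrite eq_le nrm_ge0 andbT; have := nrm_op A x; rewrite A0 mul0r.
Qed.

Lemma opnormZ_le a A : opnorm (a *: A) <= complex.Re `|a| * opnorm A.
Proof.
have a0 : 0 <= complex.Re `|a| by rewrite -ler0c RRe_real ?ger0_real.
apply: opnorm_le; split=> [|x]; first by rewrite mulr_ge0// opnorm_ge0.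
by rewrite opZ nrmZ -mulrA ler_wpM2l// nrm_op.
Qed.

Lemma opnormZ a A : opnorm (a *: A) = complex.Re `|a| * opnorm A.
Proof.
apply/eqP; rewrite eq_le opnormZ_le andTb.
have [->|a0] := eqVneq a 0; first by rewrite normr0 mul0r opnorm_ge0.
have Na0 : 0 < complex.Re `|a| by rewrite -ltcR RRe_real ?normr_gt0// ger0_real.
rewrite -ler_pdivlMl//.
have := opnormZ_le a^-1 (a *: A); rewrite scalerA mulVf// scale1r.
suff -> : complex.Re `|a^-1| = (complex.Re `|a|)^-1 by [].
by apply: complexI; rewrite fmorphV !RRe_real ?ger0_real// normfV.
Qed.

Lemma opnormB A B : opnorm (A - B) = opnorm (B - A).
Proof.
by rewrite -opprB -scaleN1r opnormZ normrN1 mul1r.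
Qed.

Definition op_norm A : R[i] := (opnorm A)%:C%C.

Fact op_normD A B : op_norm (A + B) <= op_norm A + op_norm B.
Proof. by rewrite -rmorphD lecR opnormD. Qed.

Fact op_normZ a A : op_norm (a *: A) = `|a| * op_norm A.
Proof. by rewrite /op_norm opnormZ rmorphM -[in RHS](@RRe_real _ `|a|) ?ger0_real. Qed.

Fact op_norm_eq0 A : op_norm A = 0 -> A = 0.
Proof. by move=> /complexI/opnorm_eq0. Qed.

HB.instance Definition _ :=
  Lmodule_isNormed.Build R[i] operator op_normD op_normZ op_norm_eq0.

Lemma op_normE A : `|A| = (opnorm A)%:C%C. Proof. by []. Qed.

Lemma mulop_subproof A B : (A : H -> H) \o B \in adjointable_pred.
Proof.
have /asboolP[AL [A' AA'] _] := opvalP A; have /asboolP[BL [B' BB'] _] := opvalP B.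
apply/asboolP; split.
- by move=> a x y /=; rewrite BL AL.
- by exists (B' \o A') => x y /=; rewrite AA' BB'.
- exists (opnorm A * opnorm B); split=> [|x]; first by rewrite mulr_ge0// opnorm_ge0.
  rewrite (le_trans (nrm_op _ _))// -mulrA ler_wpM2l ?opnorm_ge0//.
  exact: nrm_op.
Qed.

Definition mulop A B := Operator (mulop_subproof A B).

(** Linearity follows from nondegeneracy of [inner], and the bound from
    [|A' x|^2 = inner x (A (A' x))] after cancelling one factor [|A' x|]. *)
Lemma adjop_exists A : exists B, is_adjoint A B.
Proof.
have /asboolP[_ [A' AA'] _] := opvalP A.
have A'A x y : inner (A' x) y = inner x (A y) by rewrite innerC -AA' innerC.
suff A'P : A' \in adjointable_pred by exists (Operator A'P).
apply/asboolP; split.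
- move=> a x y; apply: inner_ext => z; rewrite -AA' !innerDr -AA' !innerZl -opxZ AA'.
  by rewrite -AA'.
- by exists A.
- exists (opnorm A); split=> [|x]; first exact: opnorm_ge0.
  have [->|x0] := eqVneq (nrm (A' x)) 0; first by rewrite mulr_ge0 ?opnorm_ge0 ?nrm_ge0.
  have {}x0 : 0 < nrm (A' x) by rewrite lt0r x0 nrm_ge0.
  rewrite -(ler_pM2r x0) -expr2 nrm2 A'A (le_trans (cauchy_schwarz _ _))//.
  by rewrite mulrC mulrAC ler_wpM2r ?nrm_ge0// nrm_op.
Qed.

Definition adjop A : operator := projT1 (cid (adjop_exists A)).

Lemma adjopP A x y : inner (A x) y = inner x (adjop A y).
Proof. exact: (projT2 (cid (adjop_exists A))). Qed.

Lemma adjop_unique A B : is_adjoint A B -> adjop A = B.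
Proof.
by move=> AB; apply: opE => y; apply: inner_ext => z; rewrite -adjopP AB.
Qed.

Fact adjopK : involutive adjop.
Proof.
by move=> A; apply: adjop_unique => x y; rewrite innerC -adjopP innerC.
Qed.

Fact adjopD A B : adjop (A + B) = adjop A + adjop B.
Proof.
by apply: adjop_unique => x y; rewrite !opD innerDl innerDr !adjopP.
Qed.

Fact adjopZ a A : adjop (a *: A) = Num.conj a *: adjop A.
Proof.
by apply: adjop_unique => x y; rewrite !opZ innerZ adjopP opxZ.
Qed.

Fact adjopM A B : adjop (mulop A B) = mulop (adjop B) (adjop A).
Proof. by apply: adjop_unique => x y /=; rewrite !adjopP. Qed.

Lemma opnormM A B : opnorm (mulop A B) <= opnorm A * opnorm B.
Proof.
apply: opnorm_le; split=> [|x]; first by rewrite mulr_ge0// opnorm_ge0.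
by rewrite (le_trans (nrm_op A (B x)))// -mulrA ler_wpM2l ?opnorm_ge0// nrm_op.
Qed.

Lemma opnorm_adj A : opnorm (adjop A) = opnorm A.
Proof.
suff le B : opnorm (adjop B) <= opnorm B.
  by apply/eqP; rewrite eq_le le -{1}(adjopK A) le.
apply: opnorm_le; split=> [|x]; first exact: opnorm_ge0.
have [->|x0] := eqVneq (nrm (adjop B x)) 0.
  by rewrite mulr_ge0 ?opnorm_ge0 ?nrm_ge0.
have {}x0 : 0 < nrm (adjop B x) by rewrite lt0r x0 nrm_ge0.
rewrite -(ler_pM2r x0) -expr2 nrm2 -adjopP (le_trans (cauchy_schwarz _ _))//.
by rewrite mulrAC ler_wpM2r ?nrm_ge0// nrm_op.
Qed.

(** The nontrivial inequality comes from [|A x|^2 = inner x (adjop A (A x))] and Cauchy-Schwarz,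
    which make the square root of the left side a bound for [A]. *)
Lemma opnorm_adjM A : opnorm (mulop (adjop A) A) = opnorm A ^+ 2.
Proof.
apply/eqP; rewrite eq_le; apply/andP; split.
  by rewrite (le_trans (opnormM _ _))// opnorm_adj.
set M := opnorm (mulop _ _); have M0 : 0 <= M by exact: opnorm_ge0.
rewrite -(sqr_sqrtr M0) ler_pXn2r ?nnegrE ?opnorm_ge0 ?sqrtr_ge0//.
apply: opnorm_le; split=> [|x]; first exact: sqrtr_ge0.
apply: nrm_le; first by rewrite mulr_ge0 ?sqrtr_ge0 ?nrm_ge0.
rewrite exprMn sqr_sqrtr// adjopP (le_trans (cauchy_schwarz _ _))//.
by rewrite mulrC expr2 mulrA ler_wpM2r ?nrm_ge0//; exact: (nrm_op (mulop _ _)).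
Qed.

(* The limit exists coordinatewise, and bounds on finite sums of coordinates
   pass to the limit. *)
Lemma op_cauchy_limit (T : Type) (F : set_system T) {FF : ProperFilter F}
  (Op : T -> operator) :
  (forall e : R, 0 < e -> exists2 D, F D &
    forall s t, D s -> D t -> opnorm (Op s - Op t) <= e) ->
  exists2 L : H -> H, (forall a x y, L (a *: x + y) = a *: L x + L y) &
    forall e : R, 0 < e -> exists2 D, F D &
      forall s, D s -> forall x, nrm (Op s x - L x) <= e * nrm x.
Proof.
move=> cauchyF.
pose co (g : R[i] -> R) x i t := g (Op t x i).
(* Real and imaginary parts are treated together: [g] respects differences and is dominated by the
   modulus. *)
have cvg_co (g : R[i] -> R) : (forall z w, g z - g w = g (z - w)) ->
    (forall z, (g z) ^+ 2 <= rdot z z) -> forall x i, cvg (co g x i @ F).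
  move=> gB g2 x i; apply/cauchy_cvgP/cauchy_exP => e e0.
  have x1 : 0 < nrm x + 1 by rewrite ltr_wpDl// nrm_ge0.
  have [|D FD De] := cauchyF (e / 2 / (nrm x + 1)); first by rewrite !divr_gt0.
  have [s Ds] := filter_ex FD.
  exists (co g x i s); change (F [set t | ball (co g x i s) e (co g x i t)]).
  apply: filterS FD => t Dt.
  rewrite /= -ball_normE /ball_/= /co gB -ltr_sqr ?nnegrE// ?ltW// real_normK ?num_real//.
  rewrite (le_lt_trans (g2 _))// (le_lt_trans (rdot_le_inner (Op s x - Op t x) i))//.
  rewrite -nrm2 ltr_sqr ?nnegrE ?nrm_ge0 ?ltW//.
  rewrite (le_lt_trans (nrm_op (Op s - Op t) x))//.
  rewrite (@le_lt_trans _ _ (e / 2 / (nrm x + 1) * (nrm x + 1)))//.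
    by rewrite ler_pM ?opnorm_ge0 ?nrm_ge0 ?De// lerDl.
  by rewrite divfK ?gt_eqF// ltr_pdivrMr// ltr_pMr// ltr1n.
have Re_cvg x i : cvg (co (@complex.Re R) x i @ F).
  apply: cvg_co => [[a b] [c d]//|[a b]].
  by rewrite /rdot/= -!expr2 lerDl sqr_ge0.
have Im_cvg x i : cvg (co (@complex.Im R) x i @ F).
  apply: cvg_co => [[a b] [c d]//|[a b]].
  by rewrite /rdot/= -!expr2 lerDr sqr_ge0.
pose l x i : R[i] :=
  Complex (lim (co (@complex.Re R) x i @ F)) (lim (co (@complex.Im R) x i @ F)).
(* The Cauchy estimate on finitely many coordinates, with [t] sent to the limit along [F] while [s]
   stays fixed. *)
have close (e : R) D s x (G : {fset I}) : 0 < e -> F D -> D s ->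
    (forall s t, D s -> D t -> opnorm (Op s - Op t) <= e) ->
    \sum_(i <- G) rdot (Op s x i - l x i) (Op s x i - l x i) <= (e * nrm x) ^+ 2.
  move=> e0 FD Ds De; pose d t i := Op s x i - Op t x i.
  have dl : \sum_(i <- G) rdot (d t i) (d t i) @[t --> F] -->
      \sum_(i <- G) rdot (Op s x i - l x i) (Op s x i - l x i).
    apply: cvg_big => [|i _]; first exact: add_continuous.
    rewrite [X in X @ _ --> _](_ : _ = fun t =>
      (co (@complex.Re R) x i s - co (@complex.Re R) x i t) ^+ 2 +
      (co (@complex.Im R) x i s - co (@complex.Im R) x i t) ^+ 2); last first.
      apply/funext => t; rewrite /d /co /rdot.
      by case: (Op s x i) (Op t x i) => [a b] [a' b'].
    rewrite (_ : rdot _ _ = (co (@complex.Re R) x i s - complex.Re (l x i)) ^+ 2 +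
      (co (@complex.Im R) x i s - complex.Im (l x i)) ^+ 2); last first.
      by rewrite /co /rdot/=; case: (Op s x i) => [a b].
    have sqB (c : R) (h : T -> R) m : h @ F --> m ->
        (c - h t) ^+ 2 @[t --> F] --> (c - m) ^+ 2.
      move=> hm; rewrite expr2; under eq_cvg do rewrite expr2.
      by apply: cvgM; apply: cvgB => //; exact: cvg_cst.
    by apply: cvgD; apply: sqB; [exact: Re_cvg | exact: Im_cvg].
  apply: (cvgr_to_le dl); apply: filterS FD => t Dt.
  rewrite (le_trans (sum_le_inner (Op s x - Op t x) G))// -nrm2.
  rewrite ler_sqr ?nnegrE ?nrm_ge0//; last by rewrite mulr_ge0 ?nrm_ge0// ltW.
  by rewrite (le_trans (nrm_op (Op s - Op t) x))// ler_wpM2r ?nrm_ge0// De.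
have lP x : l x \in square_summable_pred.
  have [D FD De] := cauchyF 1 ltr01; have [s Ds] := filter_ex FD.
  have dP : (fun i => Op s x i - l x i) \in square_summable_pred.
    by apply/asboolP; exists ((1 * nrm x) ^+ 2) => G; exact: close De.
  have -> : l x = (Op s x : I -> R[i]) - (fun i => Op s x i - l x i).
    by apply/funext => i; rewrite !fctE opprB addrC subrK.
  by apply: rpredB => //; exact: l2valP.
exists (fun x => L2 (lP x)) => [a x y|e e0].
  apply: l2E => i; case: a => a b; rewrite l2D l2Z.
  have coRe : co (@complex.Re R) (Complex a b *: x + y) i = (fun t =>
      a * co (@complex.Re R) x i t - b * co (@complex.Im R) x i t
      + co (@complex.Re R) y i t).
    apply/funext => t; rewrite /co opL l2D l2Z.
    by case: (Op t x i) (Op t y i) => [c d] [].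
  have coIm : co (@complex.Im R) (Complex a b *: x + y) i = (fun t =>
      a * co (@complex.Im R) x i t + b * co (@complex.Re R) x i t
      + co (@complex.Im R) y i t).
    apply/funext => t; rewrite /co opL l2D l2Z.
    by case: (Op t x i) (Op t y i) => [c d] [].
  have limRe : lim (co (@complex.Re R) (Complex a b *: x + y) i @ F) =
      a * complex.Re (l x i) - b * complex.Im (l x i) + complex.Re (l y i).
    rewrite coRe; apply: cvg_lim => //; apply: cvgD; last exact: Re_cvg.
    apply: cvgB; apply: cvgM; [exact: cvg_cst|exact: Re_cvg|exact: cvg_cst|exact: Im_cvg].
  have limIm : lim (co (@complex.Im R) (Complex a b *: x + y) i @ F) =
      a * complex.Im (l x i) + b * complex.Re (l x i) + complex.Im (l y i).
    rewrite coIm; apply: cvg_lim => //; apply: cvgD; last exact: Im_cvg.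
    apply: cvgD; apply: cvgM; [exact: cvg_cst|exact: Im_cvg|exact: cvg_cst|exact: Re_cvg].
  rewrite -[LHS]/(Complex (lim (co (@complex.Re R) (Complex a b *: x + y) i @ F))
    (lim (co (@complex.Im R) (Complex a b *: x + y) i @ F))) limRe limIm.
  rewrite -[RHS]/(Complex a b * l x i + l y i).
  by case: (l x i) (l y i) => [c d] [].
have [D FD De] := cauchyF e e0; exists D => // s Ds x.
apply: nrm_le; first by rewrite mulr_ge0 ?nrm_ge0// ltW.
by apply: inner_le => G; exact: close De.
Qed.

(** Taking adjoints is isometric, so the adjoints are Cauchy too; their limit [L'] is an adjoint of
    [L], which makes [L] an operator. *)
Lemma op_complete (F : set_system operator) : ProperFilter F -> cauchy F -> cvg F.
Proof.
move=> FF cF.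
have cauchyF (e : R) : 0 < e -> exists2 D, F D &
    forall A B, D A -> D B -> opnorm (A - B) <= e.
  move=> e0; have e2 : 0 < (e / 2)%:C%C by rewrite ltcR divr_gt0.
  have [A FA] := (cauchyP F).1 cF _ e2.
  exists (ball A (e / 2)%:C%C) => // B C.
  rewrite -ball_normE /ball_/= !op_normE !ltcR => AB AC.
  rewrite -(subrKA A) (le_trans (opnormD _ _))// (splitr e) opnormB.
  by rewrite lerD// ltW.
have [L LL LF] := op_cauchy_limit cauchyF.
have [|L' L'L L'F] := @op_cauchy_limit _ F _ adjop.
  move=> e /cauchyF[D FD De]; exists D => // A B DA DB.
  have -> : adjop A - adjop B = adjop (A - B).
    by rewrite adjopD -(scaleN1r B) adjopZ rmorphN rmorph1 scaleN1r.
  by rewrite opnorm_adj De.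
have Ladj : is_adjoint L L'.
  move=> x y; apply/eqP; rewrite -subr_eq0 -normr_le0.
  apply/ler_addgt0Pr => e e0; rewrite add0r.
  (* The summand 1 keeps [c] positive, and each of the two error terms is then at most [e / 2]. *)
  pose c := nrm x * nrm y + 1.
  have c0 : 0 < c by rewrite ltr_wpDl// mulr_ge0// nrm_ge0.
  have d0 : 0 < e / 2 / c by rewrite !divr_gt0.
  have [D FD De] := LF _ d0; have [D' FD' De'] := L'F _ d0.
  have [A [DA D'A]] := filter_ex (filterI FD FD').
  have abs (u v : H) : `|inner u v| <= nrm u * nrm v.
    rewrite ler_norml cauchy_schwarz andbT lerNl -innerNl.
    by rewrite (le_trans (cauchy_schwarz _ _))// nrmN.
  have -> : inner (L x) y - inner x (L' y) =
      inner x (adjop A y - L' y) - inner (A x - L x) y.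
    by rewrite innerDl innerDr innerNl innerNr adjopP; ring.
  rewrite (le_trans (ler_normB _ _))// (splitr e) lerD// (le_trans (abs _ _))//.
    rewrite (@le_trans _ _ (nrm x * (e / 2 / c * nrm y)))//.
      by rewrite ler_wpM2l ?nrm_ge0// De'.
    rewrite mulrCA mulrAC ler_pdivrMr// ler_wpM2l ?divr_ge0// ?ltW// /c.
    by rewrite ltrDl.
  rewrite (@le_trans _ _ (e / 2 / c * nrm x * nrm y))//.
    by rewrite ler_wpM2r ?nrm_ge0// De.
  rewrite -mulrA mulrAC ler_pdivrMr// ler_wpM2l ?divr_ge0// ?ltW// /c.
  by rewrite ltrDl.
have Lop : L \in adjointable_pred.
  apply/asboolP; split=> //; first by exists L'.
  have [D FD De] := LF 1 ltr01; have [A DA] := filter_ex FD.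
  exists (opnorm A + 1); split=> [|x]; first by rewrite addr_ge0// opnorm_ge0.
  have -> : L x = A x - (A x - L x) by rewrite opprB addrC subrK.
  rewrite (le_trans (nrmD _ _))// nrmN mulrDl.
  exact: (lerD (nrm_op A x) (De A DA x)).
apply/cvg_ex; exists (Operator Lop); apply/cvgrPdist_le => e e0.
have re : e = (complex.Re e)%:C%C by rewrite RRe_real// ger0_real// ltW.
have /LF[D FD De] : 0 < complex.Re e by rewrite -ltcR -re.
apply: filterS FD => A DA; rewrite op_normE re lecR opnormB.
apply: opnorm_le; split=> [|x]; last exact: De.
by rewrite -lecR -re ltW.
Qed.

HB.instance Definition _ := Uniform_isComplete.Build operator op_complete.

Fact mulopA : associative mulop.
Proof. by move=> A B C; apply: opE. Qed.

Fact mulopDl : left_distributive mulop +%R.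
Proof. by move=> A B C; apply: opE. Qed.

Fact mulopDr : right_distributive mulop +%R.
Proof. by move=> A B C; apply: opE => x; exact: opxD. Qed.

Fact scaler_mulopl (a : R[i]) A B : a *: mulop A B = mulop (a *: A) B.
Proof. exact: opE. Qed.

Fact scaler_mulopr (a : R[i]) A B : a *: mulop A B = mulop A (a *: B).
Proof. by apply: opE => x; rewrite !opZ /= opxZ. Qed.

Fact op_norm_mulop A B : `|mulop A B| <= `|A| * `|B|.
Proof. by rewrite !op_normE -rmorphM lecR opnormM. Qed.

Fact op_norm_adjop A : `|mulop (adjop A) A| = `|A| ^+ 2.
Proof. by rewrite !op_normE opnorm_adjM rmorphXn. Qed.

HB.instance Definition _ := CompleteNormedModule_isCStarAlgebra.Build R operator
  mulopA mulopDl mulopDr scaler_mulopl scaler_mulopr op_norm_mulop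
  adjopK adjopD adjopZ adjopM op_norm_adjop.

End Operators.
Arguments operator : clear implicits.

(** * Paths in a higher-rank graph *)

Section Paths.
Context {k : nat} {L : kgraph k}.
Local Notation pcomp := Defs.pcomp.
Implicit Types (a b l m n q : kpath L) (p : kpath L * kpath L) (v w : kvertex L).

Lemma degree_addI (d e f : {ffun 'I_k -> nat}) : d + e = d + f -> e = f.
Proof.
move/ffunP => H; apply/ffunP => i; have := H i.
by rewrite !ffunE; exact: addnI.
Qed.

(** The uniqueness half of the factorisation property: equal first degrees force equal second
    degrees. *)
Lemma pcomp_inj a b a' b' : src a = rng b -> src a' = rng b' ->
  deg a = deg a' -> pcomp a b = pcomp a' b' -> a = a' /\ b = b'.
Proof.
move=> ab ab' daa' abE.
have dbb' : deg b = deg b'.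
  by apply: (@degree_addI (deg a)); rewrite -deg_pcomp// abE deg_pcomp// daa'.
have [[c d] [_ cdu]] := factorisation (deg_pcomp ab).
have [<- <-] := cdu (a, b) (And4 erefl erefl ab erefl).
by have [<- <-] := cdu (a', b') (And4 (esym daa') (esym dbb') ab' abE).
Qed.

Lemma pcompI a b b' : src a = rng b -> src a = rng b' ->
  pcomp a b = pcomp a b' -> b = b'.
Proof. by move=> ab ab' abE; have [] := pcomp_inj ab ab' erefl abE. Qed.

Definition pre l m := exists2 n, src l = rng n & m = pcomp l n.

Lemma prexx l : pre l l.
Proof. by exists (idp (src l)); rewrite ?rng_idp ?pcomp_idr. Qed.

Lemma pre_trans l m n : pre l m -> pre m n -> pre l n.
Proof.
move=> [p lp ->] [q]; rewrite src_pcomp// => pq ->.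
by exists (pcomp p q); rewrite ?rng_pcomp// pcompA.
Qed.

Lemma pre_pcomp l m : src l = rng m -> pre l (pcomp l m).
Proof. by exists m. Qed.

Lemma pre_rng l m : pre l m -> rng l = rng m.
Proof. by case=> n ln ->; rewrite rng_pcomp. Qed.

Lemma pre_idp l : pre (idp (rng l)) l.
Proof. by exists l; rewrite ?src_idp ?pcomp_idl. Qed.

Lemma pre_pcompI a b c : src a = rng b -> src a = rng c ->
  pre (pcomp a b) (pcomp a c) -> pre b c.
Proof.
move=> ab ac [n]; rewrite src_pcomp// => bn; rewrite -pcompA// => /pcompI H.
by exists n => //; apply: H => //; rewrite rng_pcomp.
Qed.

Lemma pre_pcompl a b c : src a = rng b -> pre b c -> pre (pcomp a b) (pcomp a c).
Proof.
by move=> ab [n bn ->]; exists n; rewrite ?src_pcomp// pcompA.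
Qed.

Lemma pre_deg l m : pre l m -> forall i, (deg l i <= deg m i)%N.
Proof. by case=> n ln -> i; rewrite deg_pcomp// ffunE leq_addr. Qed.

Lemma pre_factor q (d : {ffun 'I_k -> nat}) : (forall i, (d i <= deg q i)%N) ->
  exists2 p, pre p q & deg p = d.
Proof.
move=> dq; have dE : deg q = d + [ffun i => (deg q i - d i)%N].
  by apply/ffunP => i; rewrite !ffunE; apply/esym/subnKC.
have [[p n] [[/= <- _ pn qE] _]] := factorisation dE.
by exists p => //; exists n.
Qed.

(** Cutting [m] at degree [deg l] yields another initial segment of [q] of that degree, which must
    be [l]. *)
Lemma pre_deg_pre l m q : pre l q -> pre m q ->
  (forall i, (deg l i <= deg m i)%N) -> pre l m.
Proof.
move=> [l' ll' ->] [m' mm' qE] lm.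
have [p [n pn mE] dp] := pre_factor lm.
have nm' : src n = rng m' by rewrite -mm' mE src_pcomp.
have [] := @pcomp_inj l l' p (pcomp n m'); rewrite ?rng_pcomp//.
  by rewrite qE mE pcompA.
by move=> -> _; exists n.
Qed.

(** Every common extension passes through a minimal one, namely its initial segment of degree
    [djoin (deg l) (deg m)]. *)
Lemma common_ext l m q : pre l q -> pre m q ->
  exists2 p, Lmin l m p & pre (pcomp l p.1) q.
Proof.
move=> lq mq; have [|t tq dt] := @pre_factor q (djoin (deg l) (deg m)).
  by move=> i; rewrite ffunE geq_max !pre_deg.
have [|a la tE] := pre_deg_pre lq tq.
  by move=> i; rewrite dt ffunE leq_maxl.
have [|b mb tE'] := pre_deg_pre mq tq.
  by move=> i; rewrite dt ffunE leq_maxr.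
by exists (a, b); [split; rewrite -?tE | rewrite /= -tE].
Qed.

Lemma Lmin_pre l m p : Lmin l m p -> pre l (pcomp l p.1) /\ pre m (pcomp l p.1).
Proof. by case: p => a b [/= la mb E _]; split; [exists a | exists b]. Qed.

(** Both minimal extensions are initial segments of [q] of the same degree. Hence at most one
    summand of the product relation acts on a given boundary path. *)
Lemma Lmin_unique l m p p' q : Lmin l m p -> Lmin l m p' ->
  pre (pcomp l p.1) q -> pre (pcomp l p'.1) q -> p = p'.
Proof.
case: p p' => [a b] [a' b'] [/= la mb E D] [/= la' mb' E' D'].
move=> [x ax ->] [x' ax' qE].
have [aa' _] : pcomp l a = pcomp l a' /\ x = x'.
  by apply: pcomp_inj => //; rewrite D D'.
have <- : a = a' by exact: pcompI aa'.
by congr pair; apply: pcompI mb mb' _; rewrite -E -E' aa'.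
Qed.

Lemma Lmin_prefix l n : src l = rng n -> Lmin l (pcomp l n) = [set (n, idp (src n))].
Proof.
move=> ln; have dE : djoin (deg l) (deg (pcomp l n)) = deg (pcomp l n).
  by apply/ffunP => i; rewrite ffunE; apply/maxn_idPr/pre_deg/pre_pcomp.
have nP : Lmin l (pcomp l n) (n, idp (src n)).
  split=> //=; first by rewrite rng_idp src_pcomp.
  by rewrite -(src_pcomp ln) pcomp_idr.
apply/seteqP; split=> [p pP /=|_ ->//].
have [_ pre2] := Lmin_pre pP.
apply: Lmin_unique pP nP (prexx _) _ => /=; exact: pre2.
Qed.

Lemma Lmin_refl l : Lmin l l = [set (idp (src l), idp (src l))].
Proof.
have := @Lmin_prefix l (idp (src l)); rewrite rng_idp pcomp_idr src_idp.
exact.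
Qed.

Lemma Lmin_rng l m p : Lmin l m p -> rng l = rng m.
Proof. by move=> /Lmin_pre[/pre_rng -> /pre_rng ->]. Qed.

Lemma exhaustive_neq0 v (E : set (kpath L)) : exhaustive v E -> E !=set0.
Proof.
by move=> [_ /(_ (idp v))]; rewrite /paths_to/= rng_idp => /(_ erefl)[l El _]; exists l.
Qed.

(* The set Ext(t; E) of minimal extensions of [t] into [E]. *)
Lemma ext_exhaustive (E : {fset kpath L}) t : finitely_aligned L ->
  exhaustive (rng t) [set` E] ->
  exists2 E' : {fset kpath L}, exhaustive (src t) [set` E'] &
    forall b, b \in E' -> exists2 n, n \in E & exists a, Lmin n t (a, b).
Proof.
move=> fin [Er Ex].
pose D := \bigcup_(n in [set` E]) (snd @` Lmin n t).
have Dfin : finite_set D.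
  by apply: bigcup_finite => [|n _]; [exact: finite_fset | exact: finite_image].
exists (fset_set D); last first.
  move=> b; rewrite in_fset_set// inE => -[n nE [[a b'] nP <-]].
  by exists n => //; exists a.
rewrite fset_setK//; split=> [b [n _ [[a b'] [_ /= tb _ _] /= <-]]|m tm].
  exact: esym.
(* Exhaustiveness is tested on [pcomp t m]. The resulting common extension with some [n] in [E]
   contains a minimal extension of [n] and [t], whose second entry has a common extension with
   [m]. *)
have [|n nE [[a0 b0] [/= na0 mb0 E0 _]]] := Ex (pcomp t m).
  by rewrite /paths_to/= rng_pcomp.
have mb0' : src m = rng b0 by rewrite -mb0 src_pcomp.
have tmb : src t = rng (pcomp m b0) by rewrite rng_pcomp.
have E1 : pcomp n a0 = pcomp t (pcomp m b0) by rewrite E0 pcompA.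
have nq : pre n (pcomp t (pcomp m b0)) by exists a0.
have [[a b] nP abq] := common_ext nq (pre_pcomp tmb).
exists b; first by exists n => //; exists (a, b).
have [_ /= tb E2 _] := nP; move: abq; rewrite /= E2 => /(pre_pcompI tb tmb) bq.
by have [p bmp _] := common_ext bq (pre_pcomp mb0'); exists p.
Qed.

End Paths.

(** * Boundary paths as filters of initial segments *)

Section BoundaryFilters.
Context {k : nat} {L : kgraph k} (S : set (kvertex L)).
Local Notation pcomp := Defs.pcomp.
Implicit Types (a b l m n q : kpath L) (p : kpath L * kpath L) (v w : kvertex L)
  (y z : set (kpath L)).

(* The set of initial segments of a boundary path of [L] which does not visit
   [S]; the empty set is allowed, but contains no vertex. *)
Definition boundary_filter y : Prop :=
  [/\ forall l m, pre l m -> y m -> y l,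
      forall l m, y l -> y m -> exists2 p, Lmin l m p & y (pcomp l p.1),
      forall l (E : {fset kpath L}), y l -> exhaustive (src l) [set` E] ->
        exists2 n, n \in E & y (pcomp l n)
    & forall l, y l -> ~ S (src l)].

Lemma boundary_filter_pre y l m : boundary_filter y -> pre l m -> y m -> y l.
Proof. by case=> + _ _ _; exact. Qed.

Lemma boundary_filter_ext y a b : boundary_filter y ->
  y a -> y b -> exists2 p, Lmin a b p & y (pcomp a p.1).
Proof. by case=> _ + _ _; exact. Qed.

(* The filter [b sigma^a(y)]. *)
Definition swap a b y : set (kpath L) :=
  [set m | exists n, [/\ src a = rng n, y (pcomp a n) & pre m (pcomp b n)]].

Lemma swapE a b y n : boundary_filter y -> src a = src b -> src b = rng n ->
  swap a b y (pcomp b n) <-> y (pcomp a n).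
Proof.
move=> yB ab bn; split=> [[n' [an' yn' bnn']]|yn].
  have bn' : src b = rng n' by rewrite -ab.
  have [e ne n'E] := pre_pcompI bn bn' bnn'.
  apply: boundary_filter_pre yB _ yn'.
  by apply: pre_pcompl; [rewrite ab | exists e].
by exists n; split; [rewrite ab | | exact: prexx].
Qed.

Lemma swap_mem a b y : boundary_filter y -> src a = src b -> y a -> swap a b y b.
Proof.
move=> yB ab ya; rewrite -{2}(pcomp_idr b) swapE ?rng_idp//.
by rewrite -ab pcomp_idr.
Qed.

(** Every member has a common extension with [b] inside the filter, so the members extending [b] are
    cofinal and determine it. *)
Lemma boundary_filter_eq b y z : boundary_filter y -> boundary_filter z ->
  y b -> z b -> (forall n, src b = rng n -> y (pcomp b n) <-> z (pcomp b n)) ->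
  y = z.
Proof.
have half y' z' : boundary_filter y' -> boundary_filter z' -> y' b ->
    (forall n, src b = rng n -> y' (pcomp b n) -> z' (pcomp b n)) -> y' `<=` z'.
  move=> yB zB yb yz m ym.
  have [p bmp ybp] := boundary_filter_ext yB yb ym.
  apply: (boundary_filter_pre zB (Lmin_pre bmp).2).
  by apply: yz => //; case: bmp.
move=> yB zB yb zb yz; apply/seteqP.
by split; apply: half => // n bn; [exact: (yz n bn).1 | exact: (yz n bn).2].
Qed.

Hypotheses (L_aligned : finitely_aligned L) (S_hereditary : hereditary S).

Lemma pre_hereditary l m : pre l m -> S (src l) -> S (src m).
Proof.
move=> [n ln ->] Sl; have : paths_to (src l) n by exact: esym.
by rewrite (S_hereditary Sl) src_pcomp// => -[].
Qed.

Lemma swap_boundary a b y : boundary_filter y -> src a = src b ->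
  boundary_filter (swap a b y).
Proof.
move=> yB ab; split.
- move=> l m lm [n [an yn mn]]; exists n; split=> //; exact: pre_trans lm mn.
- move=> l m [n [an yn ln]] [n' [an' yn' mn']].
  have [[c d] [/= nc nd E D] yc] := boundary_filter_ext yB yn yn'.
  have {}nc : src n = rng c by rewrite -nc src_pcomp.
  have {}nd : src n' = rng d by rewrite -nd src_pcomp.
  have e : pcomp n c = pcomp n' d.
    by apply: (@pcompI _ _ a); rewrite ?rng_pcomp// !pcompA.
  have bl : pre l (pcomp b (pcomp n c)).
    by apply: pre_trans ln _; apply: pre_pcompl (pre_pcomp nc); rewrite -ab.
  have bm : pre m (pcomp b (pcomp n c)).
    rewrite e; apply: pre_trans mn' _.
    by apply: pre_pcompl (pre_pcomp nd); rewrite -ab.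
  have [p lmp pq] := common_ext bl bm; exists p => //.
  exists (pcomp n c); split=> //; first by rewrite rng_pcomp.
  by rewrite pcompA.
(* The set [E] starts at the source of [l], while [y] is known only past [a]. Transported along [t]
   it becomes an exhaustive set at the source of [n], which [y] meets. *)
- move=> l E [n [an yn [t lt nE]]] Ex.
  have [|E' E'x E'P] := @ext_exhaustive _ _ E t L_aligned; first by rewrite -lt.
  have [_ _ yE _] := yB.
  have [|c cE' yc] := yE (pcomp a n) E' yn.
    by rewrite src_pcomp// -(@src_pcomp _ _ b) -?ab// nE src_pcomp.
  have [nu nuE [al [/= nual tc E2 _]]] := E'P _ cE'.
  have tn : src n = src t by rewrite -(@src_pcomp _ _ b) -?ab// nE src_pcomp.
  have lnu : src l = rng nu by rewrite (esym (Ex.1 _ nuE)).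
  exists nu => //; exists (pcomp n c); split.
  + by rewrite rng_pcomp// tn.
  + by rewrite pcompA// tn.
  + exists al; first by rewrite src_pcomp.
    by rewrite -pcompA// E2 !pcompA ?tn -?nE// -ab.
- move=> l [n [an yn lbn]] Sl; have [_ _ _ yS] := yB; apply: (yS _ yn).
  by rewrite src_pcomp// -(@src_pcomp _ _ b) -?ab//; exact: pre_hereditary Sl.
Qed.

Lemma swapK a b y : boundary_filter y -> src a = src b -> y a ->
  swap b a (swap a b y) = y.
Proof.
move=> yB ab ya; have zB := swap_boundary yB ab.
have zb := swap_mem yB ab ya.
apply: (@boundary_filter_eq a) => //; first exact: swap_boundary.
  exact: swap_mem.
by move=> n an; rewrite swapE// swapE// -ab.
Qed.

Lemma swap_id a y : boundary_filter y -> y a -> swap a a y = y.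
Proof.
move=> yB ya; apply: (@boundary_filter_eq a) => //; first exact: swap_boundary.
  exact: swap_mem.
by move=> n an; rewrite swapE.
Qed.

(** The pointwise form of the product relation: where the summand indexed by [p] is defined, its
    path map is the composite of the two factors' maps. The filters are compared on extensions of
    [pcomp m p.2]. *)
Lemma swap_swap a b l m y p : boundary_filter y -> src a = src b ->
  src l = src m -> Lmin b l p -> y (pcomp a p.1) ->
  [/\ y a, swap a b y l &
     swap (pcomp a p.1) (pcomp m p.2) y = swap l m (swap a b y)].
Proof.
case: p => c d /= yB ab lm [/= bc ld E _] yac.
have ac : src a = rng c by rewrite ab.
have ya : y a by apply: boundary_filter_pre yB (pre_pcomp ac) yac.
have zB := swap_boundary yB ab.
have zbc : swap a b y (pcomp b c) by rewrite swapE.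
have zl : swap a b y l.
  by apply: boundary_filter_pre zB _ zbc; rewrite E; exact: pre_pcomp.
have md : src m = rng d by rewrite -lm.
have cd : src c = src d by rewrite -(src_pcomp bc) E src_pcomp.
have acmd : src (pcomp a c) = src (pcomp m d) by rewrite !src_pcomp.
split=> //; apply: (@boundary_filter_eq (pcomp m d)).
- exact: swap_boundary.
- exact: swap_boundary.
- exact: swap_mem.
- by rewrite swapE// -E.
- move=> n; rewrite src_pcomp// => dn; have cn : src c = rng n by rewrite cd.
  rewrite swapE// ?src_pcomp// -pcompA// -(@pcompA _ _ m)// swapE// ?rng_pcomp//.
  by rewrite (@pcompA _ _ l d n)// -E -(@pcompA _ _ b c n)// swapE ?rng_pcomp.
Qed.

Hypothesis S_saturated : saturated S.

(** If all paths of the transported exhaustive set at [src l] ended in [S], saturation would put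
    [src l] into [S]; so one of them leads on outside [S]. *)
Lemma boundary_step l m (E : {fset kpath L}) : ~ S (src l) -> pre m l ->
  exhaustive (src m) [set` E] ->
  exists l', [/\ pre l l', ~ S (src l') & exists2 n, n \in E & pre (pcomp m n) l'].
Proof.
move=> lS [t mt lE] Ex.
have [|E' E'x E'P] := @ext_exhaustive _ _ E t L_aligned; first by rewrite -mt.
have lt : src l = src t by rewrite lE src_pcomp.
have [b bE' bS] : exists2 b, b \in E' & ~ S (src b).
  apply: contrapT => nP; apply: lS; rewrite lt; apply: S_saturated.
  exists E'; split=> // b bE'; split; first exact: (E'x.1 _ bE').
  by apply: contrapT => bS; apply: nP; exists b.
have [n nE [a [/= na tb E2 _]]] := E'P _ bE'.
have mn : src m = rng n by rewrite (esym (Ex.1 _ nE)).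
have lb : src l = rng b by rewrite lt.
exists (pcomp l b); split; [exact: pre_pcomp | by rewrite src_pcomp|].
exists n => //; exists a; first by rewrite src_pcomp.
by rewrite lE -!pcompA// E2.
Qed.

Lemma boundary_filter_exists w : ~ S w ->
  exists2 y, boundary_filter y & y (idp w).
Proof.
move=> wS.
(* One step serves one request [(m, E)]: if [m] is an initial segment of the current path and [E] is
   exhaustive at its source, the path is prolonged through [E]. *)
have next (c : kpath L * (kpath L * {fset kpath L})) : exists l', ~ S (src c.1) ->
    [/\ pre c.1 l', ~ S (src l') & pre c.2.1 c.1 ->
      exhaustive (src c.2.1) [set` c.2.2] ->
      exists2 n, n \in c.2.2 & pre (pcomp c.2.1 n) l'].
  case: c => l [m E] /=.
  have [[lS ml Ex]|nP] := pselect [/\ ~ S (src l), pre m l & exhaustive (src m) [set` E]].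
    by have [l' [ll' l'S l'E]] := boundary_step lS ml Ex; exists l'.
  by exists l => lS; split=> // [|ml Ex]; [exact: prexx | exfalso; exact: nP].
have [g gP] := choice next.
pose decode (i : nat) : option (kpath L * {fset kpath L} * nat) := choice.unpickle i.
pose u := fix u i := if i is j.+1 then
  if decode j is Some c then g (u j, c.1) else u j else idp w.
have uE j : u j.+1 = if decode j is Some c then g (u j, c.1) else u j by [].
have uS i : ~ S (src (u i)) /\ pre (u i) (u i.+1).
  have step j : ~ S (src (u j)) -> pre (u j) (u j.+1) /\ ~ S (src (u j.+1)).
    rewrite uE => uS; case: (decode j) => [c|]; last by split=> //; exact: prexx.
    by have [] := gP (u j, c.1) uS.
  have uS j : ~ S (src (u j)).
    by elim: j => [|j /step[]//]; rewrite /= src_idp.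
  by split=> //; have [] := step i (uS i).
have umono i j : (i <= j)%N -> pre (u i) (u j).
  move=> /subnKC <-; elim: (j - i)%N => [|d IHd]; first by rewrite addn0; exact: prexx.
  by rewrite addnS; apply: pre_trans IHd _; exact: (uS _).2.
exists [set l | exists i, pre l (u i)]; last by exists 0%N; exact: prexx.
split.
- by move=> l m lm [i mi]; exists i; exact: pre_trans mi.
- move=> l m [i li] [j mj].
  have [p lmp pu] : exists2 p, Lmin l m p & pre (pcomp l p.1) (u (maxn i j)).
    apply: common_ext; [apply: pre_trans li _ | apply: pre_trans mj _]; apply: umono.
      exact: leq_maxl.
    exact: leq_maxr.
  by exists p => //; exists (maxn i j).
- move=> l E [i li] Ex.
  (* The pair [(l, E)] is decoded at infinitely many steps, hence at one after
     [l] has become an initial segment. *)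
  pose code (t : nat) : nat := choice.pickle (l, E, t).
  have codeI : injective code by move=> t t' /(pcan_inj choice.pickleK)[].
  have [t it] : exists t, (i <= code t)%N.
    (* Pigeonhole: otherwise the injective [code] would send [i.+1] numbers below [i]. *)
    apply: contrapT => nP.
    have : (size (map code (iota 0 i.+1)) <= size (iota 0 i))%N.
      apply: uniq_leq_size; first by rewrite map_inj_uniq// iota_uniq.
      move=> _ /mapP[t _ ->]; rewrite mem_iota add0n leq0n ltnNge.
      by apply/negP => it; apply: nP; exists t.
    by rewrite size_map !size_iota ltnn.
  have luj := pre_trans li (umono _ _ it).
  have [_ _] := gP (u (code t), (l, E)) (uS _).1.
  move=> /(_ luj Ex)[n nE ln]; exists n => //; exists (code t).+1.
  by rewrite uE /decode /code choice.pickleK.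
- move=> l [i li] Sl; exact: (uS i).1 (pre_hereditary li Sl).
Qed.

End BoundaryFilters.

(** * The representation on boundary paths *)

Section PartialBijection.
Context {R : realType} {I : choiceType}.
Implicit Types (D : set I) (phi : I -> I) (F G : {fset I}).

Definition partial_bijection D D' phi phi' :=
  (forall i, D i -> D' (phi i) /\ phi' (phi i) = i) /\
  (forall j, D' j -> D (phi' j) /\ phi (phi' j) = j).

Lemma partial_bijection_sym D D' phi phi' :
  partial_bijection D D' phi phi' -> partial_bijection D' D phi' phi.
Proof. by case. Qed.

Section Reindex.
Variables (D D' : set I) (phi phi' : I -> I).
Hypothesis bij : partial_bijection D D' phi phi'.
Variables (f g : I -> R).
Hypotheses (f0 : forall i, ~ D i -> f i = 0) (fg : forall i, D i -> f i = g (phi i)).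

Lemma fset_sum_reindex F : exists2 G, fset_sum f F = fset_sum g G &
  forall j, j \in G <-> exists i, [/\ i \in F, D i & j = phi i].
Proof.
pose F1 := [fset i in F | `[< D i >]]%fset.
have F1P i : i \in F1 <-> i \in F /\ D i.
  by rewrite !inE; split=> [/andP[-> /asboolP]|[-> /asboolP]].
exists [fset phi i | i in F1]%fset; last first.
  move=> j; split=> [/imfsetP[i /= /F1P[iF Di] ->]|[i [iF Di ->]]]; first by exists i.
  by apply/imfsetP; exists i => //; apply/F1P.
have F1F : (F1 `<=` F)%fset by apply/fsubsetP => i /F1P[].
rewrite /fset_sum big_imfset /=; last first.
  move=> i j /F1P[_ Di] /F1P[_ Dj] ij.
  by rewrite -(bij.1 _ Di).2 -(bij.1 _ Dj).2 ij.
rewrite -(big_fset_incl _ F1F) => [|i iF iF1].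
  by rewrite big_seq [RHS]big_seq; apply: eq_bigr => i /F1P[_ /fg].
by apply: f0 => Di; move/negP: iF1; apply; apply/F1P.
Qed.

Lemma fset_sum_reindex_cvg (l : R) : (forall j, ~ D' j -> g j = 0) ->
  fset_sum g @ totally --> l -> fset_sum f @ totally --> l.
Proof.
move=> g0 gl; apply/cvgrPdist_lt => e e0.
have [G0 _ G0e] := (cvgrPdist_lt _ _).1 gl e e0.
exists [fset phi' j | j in G0]%fset => // F /= F0F.
have [G fG GP] := fset_sum_reindex F.
have -> : fset_sum f F = fset_sum g (G `|` G0)%fset.
  rewrite fG /fset_sum; apply: big_fset_incl; first exact: fsubsetUl.
  move=> j; rewrite inE => /orP[->//|jG0] jG; apply: g0 => D'j.
  move/negP: jG; apply; apply/GP; exists (phi' j); split.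
  - by apply: (fsubsetP F0F); apply/imfsetP; exists j.
  - exact: (bij.2 _ D'j).1.
  - by rewrite (bij.2 _ D'j).2.
by apply: G0e; rewrite /= fsubsetUr.
Qed.

End Reindex.

Definition pull D phi (x : I -> R[i]) : I -> R[i] :=
  fun i => if `[< D i >] then x (phi i) else 0.

Lemma pull_in D phi x i : D i -> pull D phi x i = x (phi i).
Proof. by move=> Di; rewrite /pull; case: asboolP. Qed.

Lemma pull_out D phi x i : ~ D i -> pull D phi x i = 0.
Proof. by move=> Di; rewrite /pull; case: asboolP. Qed.

Section Pull.
Variables (D D' : set I) (phi phi' : I -> I).
Hypothesis bij : partial_bijection D D' phi phi'.

Let rdot_out (z w : R[i]) : z = 0 -> rdot z w = 0.
Proof. by move=> ->; rewrite /rdot/= !mul0r addr0. Qed.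

Lemma pull_sum_le x F (K : R) :
  (forall G, \sum_(i <- G) rdot (x i) (x i) <= K) ->
  \sum_(i <- F) rdot (pull D phi x i) (pull D phi x i) <= K.
Proof.
move=> xK; have [||G + _] := @fset_sum_reindex _ _ _ _ bij
  (fun i => rdot (pull D phi x i) (pull D phi x i)) (fun i => rdot (x i) (x i)) _ _ F.
- by move=> i Di; rewrite rdot_out// pull_out.
- by move=> i Di; rewrite !pull_in.
- by rewrite /fset_sum => ->.
Qed.

Lemma pull_square_summable (x : l2 R I) : pull D phi x \in square_summable_pred.
Proof.
have /asboolP[K xK] := l2valP x; apply/asboolP.
by exists K => F; exact: pull_sum_le.
Qed.

Definition pull_l2 (x : l2 R I) : l2 R I := L2 (pull_square_summable x).

Lemma pull_l2E x i : pull_l2 x i = pull D phi x i. Proof. by []. Qed.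

End Pull.

(** Reindexing the series along [phi] moves the pull-back from one argument to the other, with [phi]
    replaced by its inverse. *)
Lemma pull_adjoint D D' phi phi' (bij : partial_bijection D D' phi phi') :
  is_adjoint (pull_l2 bij) (pull_l2 (partial_bijection_sym bij)).
Proof.
move=> x y; have sym := partial_bijection_sym bij.
have rdot0r (z : R[i]) : rdot z 0 = 0 by rewrite /rdot/= !mulr0 addr0.
have rdot0l (z : R[i]) : rdot 0 z = 0 by rewrite rdotC rdot0r.
apply: cvg_lim => //; apply: (@fset_sum_reindex_cvg _ _ _ _ bij _
  (fun j => rdot (x j) (pull_l2 sym y j))).
- by move=> i Di; rewrite pull_l2E pull_out.
- by move=> i Di; rewrite !pull_l2E !pull_in// ?(bij.1 _ Di).2//; exact: (bij.1 _ Di).1.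
- by move=> j Dj; rewrite pull_l2E pull_out.
- exact: innerP.
Qed.

Lemma pull_adjointable D D' phi phi' (bij : partial_bijection D D' phi phi') :
  pull_l2 bij \in adjointable_pred.
Proof.
apply/asboolP; split.
- move=> a x y; apply: l2E => i; rewrite l2D l2Z !pull_l2E /pull.
  by case: asboolP => _; rewrite ?mulr0 ?addr0.
- by exists (pull_l2 (partial_bijection_sym bij)); exact: pull_adjoint.
- exists 1; split=> // x; rewrite mul1r; apply: nrm_le; first exact: nrm_ge0.
  rewrite nrm2; apply: inner_le => F; apply: (pull_sum_le bij) => G.
  exact: sum_le_inner.
Qed.

Definition pull_op D D' phi phi' (bij : partial_bijection D D' phi phi') : operator R I :=
  Operator (pull_adjointable bij).

Lemma pull_op_adj D D' phi phi' (bij : partial_bijection D D' phi phi') :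
  adj (pull_op bij) = pull_op (partial_bijection_sym bij).
Proof. by apply: adjop_unique; exact: pull_adjoint. Qed.

Lemma delta_square_summable (i : I) :
  (fun j => (j == i)%:R) \in @square_summable_pred R I.
Proof.
apply/asboolP; exists 1 => F.
have [iF|iF] := boolP (i \in F).
  rewrite (big_fsetD1 i)//= eqxx big1_seq ?addr0.
    by rewrite /rdot/= !mul1r mul0r addr0.
  by move=> j; rewrite !inE => /andP[_ /andP[/negbTE -> _]]; rewrite /rdot/= !mul0r addr0.
rewrite big1_seq// => j /andP[_ jF]; case: eqP => [ji|_].
  by move: iF; rewrite -ji jF.
by rewrite /rdot/= !mul0r addr0.
Qed.

Definition delta (i : I) : l2 R I := L2 (delta_square_summable i).

Lemma sum_opE (J : choiceType) (E : set J) (A : J -> operator R I) x i :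
  finite_set E -> (\sum_(j \in E) A j) x i = \sum_(j \in E) A j x i.
Proof.
move=> Efin; rewrite !fsbig_finite//.
exact: (@big_morph _ _ (fun B : operator R I => B x i)).
Qed.

End PartialBijection.

(** Each factor multiplies coordinate [i] by a scalar, so the product does so by the product of the
    scalars, one of which is zero. *)
Lemma prod_seq_diagonal (R : realType) (I : choiceType) (s : seq (operator R I)) (i : I) :
  s != [::] -> (forall B, B \in s -> exists c : R[i], forall x, B x i = c * x i) ->
  (exists2 B, B \in s & forall x, B x i = 0) -> forall x, prod_seq s x i = 0.
Proof.
have foldl_kill (s' : seq (operator R I)) (A : operator R I) : (forall x, A x i = 0) ->
    forall x, foldl cmul A s' x i = 0.
  by elim: s' A => //= B s' IH A A0; apply: IH => x; exact: A0.
case: s => // A s _ /=; elim: s A => [|B s IH] A diag [C].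
  by rewrite inE => /eqP ->.
rewrite inE => /orP[/eqP ->|CBs] C0 x /=.
  by apply: foldl_kill => z; exact: C0.
have [a Aa] := diag A (mem_head _ _).
have [|b Bb] := diag B; first by rewrite !inE eqxx orbT.
move: CBs; rewrite inE => /orP[/eqP CB|Cs].
  apply: foldl_kill => z; rewrite -[LHS]/(A (B z) i) Aa -CB C0 mulr0//.
apply: IH => [D|]; last by exists C; rewrite ?inE ?Cs ?orbT.
rewrite inE => /orP[/eqP ->|Ds].
  by exists (a * b) => z; rewrite -[LHS]/(A (B z) i) Aa Bb mulrA.
by apply: diag; rewrite !inE Ds !orbT.
Qed.

(** * The Cuntz-Krieger family on boundary paths *)

Section Representation.
Context {R : realType} {k : nat} {L : kgraph k} (S : set (kvertex L)).
Hypotheses (L_aligned : finitely_aligned L) (S_hereditary : hereditary S).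
Local Notation pcomp := Defs.pcomp.
Implicit Types (a b l m n : kpath L) (y : set (kpath L)).

(** The domain of [swap a b]. It is empty when the sources differ and contains only boundary
    filters, so that [rep] can be defined for all pairs on the l2 space of all sets of paths. *)
Definition through a b : set (set (kpath L)) :=
  [set y | [/\ src a = src b, boundary_filter S y & y a]].

Lemma swap_bijection a b :
  partial_bijection (through a b) (through b a) (swap a b) (swap b a).
Proof.
have half a' b' y : through a' b' y ->
    through b' a' (swap a' b' y) /\ swap b' a' (swap a' b' y) = y.
  move=> [ab yB ya]; split; last exact: (swapK L_aligned S_hereditary yB ab ya).
  by split; [exact: esym | exact: swap_boundary | apply: swap_mem yB ab ya].
by split; apply: half.
Qed.

Definition rep a b : operator R (set (kpath L)) := pull_op (swap_bijection a b).

Lemma repE a b x y : rep a b x y = pull (through a b) (swap a b) x y.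
Proof. by []. Qed.

Lemma rep_adj a b : adj (rep a b) = rep b a.
Proof. by rewrite /rep pull_op_adj; apply: opE => x; apply: l2E. Qed.

Lemma rep_mul a b l m : src a = src b -> src l = src m ->
  rep a b ** rep l m = \sum_(p \in Lmin b l) rep (pcomp a p.1) (pcomp m p.2).
Proof.
move=> ab lm; apply: opE => x; apply: l2E => y.
rewrite sum_opE; last exact: L_aligned.
rewrite -[LHS]/(rep a b (rep l m x) y) repE.
have out p : Lmin b l p -> ~ (through a b y /\ through l m (swap a b y)) ->
    rep (pcomp a p.1) (pcomp m p.2) x y = 0.
  move=> blp nD; rewrite repE pull_out// => -[_ yB yap]; apply: nD.
  have [ya zl _] := swap_swap L_aligned S_hereditary yB ab lm blp yap.
  by split; split=> //; exact: swap_boundary.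
have [[yab ylm]|nD] := pselect (through a b y /\ through l m (swap a b y)); last first.
  rewrite fsbig1 => [|p /out]; last exact.
  have [yab|yab] := pselect (through a b y); last by rewrite pull_out.
  by rewrite pull_in// repE pull_out// => ylm; apply: nD.
rewrite pull_in// repE pull_in//.
have [_ yB ya] := yab; have [_ zB zl] := ylm.
(* The filter [swap a b y] contains [b] and [l], hence a minimal common extension [p0]. By
   [Lmin_unique] all other summands vanish at [y]. *)
have [p0 bl0 z0] := boundary_filter_ext zB (swap_mem yB ab ya) zl.
have bp p : Lmin b l p -> src b = rng p.1 by case.
have y0 : y (pcomp a p0.1) by rewrite -(swapE yB ab (bp _ bl0)).
have apmp p : Lmin b l p -> src (pcomp a p.1) = src (pcomp m p.2).
  move=> blp; have [bp1 lp2 E _] := blp.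
  have e : src p.1 = src p.2 by rewrite -(src_pcomp bp1) E src_pcomp.
  by rewrite !src_pcomp -?lm ?ab.
rewrite -(@fsbig_widen _ _ _ _ [set p0]) => [||p [blp /= pp0]].
- rewrite fsbig_set1 repE pull_in.
    by have [_ _ ->] := swap_swap L_aligned S_hereditary yB ab lm bl0 y0.
  by split=> //; exact: apmp.
- by move=> _ ->.
- change (rep (pcomp a p.1) (pcomp m p.2) x y = 0).
  rewrite repE pull_out// => -[_ _ yap]; apply: pp0.
  have zp : swap a b y (pcomp b p.1) by apply/(swapE yB ab (bp _ blp)).
  have [q bq _] := boundary_filter_ext zB zp z0.
  by apply: Lmin_unique blp bl0 (Lmin_pre bq).1 (Lmin_pre bq).2.
Qed.

Lemma rep_diagonalE l x y : boundary_filter S y -> y l -> rep l l x y = x y.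
Proof.
by move=> yB yl; rewrite repE pull_in// (swap_id L_aligned S_hereditary yB yl).
Qed.

Lemma rep_ck_family : ck_family [set: kvertex L] rep.
Proof.
split.
- move=> a b [_ _ ab]; rewrite /partial_isometry rep_adj.
  apply: opE => x; apply: l2E => y.
  rewrite -[LHS]/(rep a b (rep b a (rep a b x)) y) !repE.
  have [yab|yab] := pselect (through a b y); last by rewrite !pull_out.
  have [zba swapK] := (swap_bijection a b).1 _ yab.
  by rewrite !(pull_in _ _ yab) repE (pull_in _ _ zba) swapK repE (pull_in _ _ yab).
- by move=> a b _; exact: rep_adj.
- by move=> a b l m [_ _ ab] [_ _ lm]; exact: rep_mul.
(* At the coordinate [y] each factor is multiplication by 0 or 1. If [y] is a boundary filter
   containing [idp v], it meets [E] and the factor there is 0; otherwise all factors are 0. *)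
- move=> v E _ Ex; apply: opE => x; apply: l2E => y.
  have EP l : l \in E -> rng l = v by move=> lE; exact: (Ex.1 _ lE).
  pose A l := rep (idp v) (idp v) - rep l l.
  have AE l z : A l z y = rep (idp v) (idp v) z y - rep l l z y by [].
  apply: prod_seq_diagonal.
  + have [l lE] := exhaustive_neq0 Ex; have : l \in enum_fset E by [].
    by case: (enum_fset E).
  + move=> _ /mapP[l lE ->]; have [yB|yB] := pselect (boundary_filter S y); last first.
      exists 0 => z; rewrite AE !repE !pull_out ?subrr ?mul0r//; by case.
    have [yl|yl] := pselect (y l).
      have yv : y (idp v).
        by rewrite -(EP _ lE); apply: boundary_filter_pre yB (pre_idp l) yl.
      by exists 0 => z; rewrite AE !rep_diagonalE// subrr mul0r.
    have [yv|yv] := pselect (y (idp v)).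
      by exists 1 => z; rewrite AE rep_diagonalE// repE pull_out ?subr0 ?mul1r// => -[].
    by exists 0 => z; rewrite AE !repE !pull_out ?subrr ?mul0r//; case.
  + have [[yB yv]|nyv] := pselect (boundary_filter S y /\ y (idp v)).
      have [_ _ yE _] := yB.
      have [|n nE yn] := yE _ E yv; first by rewrite src_idp.
      have {}yn : y n by move: yn; rewrite -(EP _ nE) pcomp_idl.
      exists (A n) => [|z]; first by apply/mapP; exists n.
      by rewrite AE !rep_diagonalE// subrr.
    have [l lE] := exhaustive_neq0 Ex.
    exists (A l) => [|z]; first by apply/mapP; exists l.
    rewrite AE !repE !pull_out ?subrr// => -[_ yB yl]; apply: nyv; split=> //.
    by rewrite -(EP _ lE); apply: boundary_filter_pre yB (pre_idp l) yl.
Qed.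

Lemma rep_vanish v : S v -> rep (idp v) (idp v) = 0.
Proof.
move=> Sv; apply: opE => x; apply: l2E => y; rewrite repE pull_out// => -[_ yB yv].
by have [_ _ _ /(_ _ yv)] := yB; rewrite src_idp.
Qed.

Lemma rep_neq0 w : saturated S -> ~ S w -> rep (idp w) (idp w) <> 0.
Proof.
move=> Ssat wS rep0.
have [y yB yw] := boundary_filter_exists L_aligned S_hereditary Ssat wS.
have := rep_diagonalE (@delta R _ y) yB yw.
rewrite rep0 /= eqxx => /esym/eqP; exact/negP/oner_neq0.
Qed.

End Representation.

(** * Cuntz-Krieger families and the corner *)

Section CKFamily.
Context {R : realType} {k : nat} {L : kgraph k}.
Context {A : cstarType R} (X : set (kvertex L)) (T : kpath L -> kpath L -> A).
Hypotheses (L_aligned : finitely_aligned L) (T_ck : ck_family X T).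
Local Notation pcomp := Defs.pcomp.
Implicit Types (a b c l m : kpath L) (v w : kvertex L).

Definition ck_generators : set A := [set x | exists a b, ck_index X a b /\ x = T a b].

Lemma ck_adj a b : ck_index X a b -> adj (T a b) = T b a.
Proof. by case: T_ck => _ + _ _; exact. Qed.

Lemma ck_mul a b l m : ck_index X a b -> ck_index X l m ->
  T a b ** T l m = \sum_(p \in Lmin b l) T (pcomp a p.1) (pcomp m p.2).
Proof. by case: T_ck => _ _ + _; exact. Qed.

Lemma ck_index_sym a b : ck_index X a b -> ck_index X b a.
Proof. by case=> Xa Xb ab; split. Qed.

Lemma ck_mul_mid a b c : ck_index X a b -> ck_index X b c ->
  T a b ** T b c = T a c.
Proof.
move=> ab bc; rewrite ck_mul// Lmin_refl fsbig_set1/=.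
by have [_ _ sab] := ab; have [_ _ sbc] := bc; rewrite -{1}sab sbc !pcomp_idr.
Qed.

Lemma ck_mul_vertexl v a b : X v -> ck_index X a b ->
  T (idp v) (idp v) ** T a b = if rng a == v then T a b else 0.
Proof.
move=> Xv ab; have vv : ck_index X (idp v) (idp v) by split; rewrite ?rng_idp.
have [_ _ sab] := ab; rewrite ck_mul//; case: eqP => [av|av].
  have := @Lmin_prefix _ _ (idp v) a; rewrite src_idp -av pcomp_idl => ->//.
  by rewrite fsbig_set1/= pcomp_idl sab pcomp_idr.
rewrite (_ : Lmin _ _ = set0) ?fsbig_set0//; apply/seteqP; split=> // p /Lmin_rng.
by rewrite rng_idp => va; apply: av.
Qed.

(** By the product relation and finite alignment a product of generators is a finite sum of
    generators, so their linear span is dense. *)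
Lemma ck_generators_dense (W : set A) : generated_by ck_generators ->
  closed_subspace W -> ck_generators `<=` W -> W = setT.
Proof.
move=> gen Wsub; apply: generated_dense gen _ _ Wsub.
- move=> _ [a [b [ab ->]]]; exists b, a.
  by rewrite ck_adj//; split=> //; exact: ck_index_sym.
- move=> _ _ D [a [b [ab ->]]] [l [m [lm ->]]] Dsub GD.
  rewrite ck_mul// (fsbig_finite _ _ (L_aligned b l)).
  rewrite big_seq; apply: (closed_subspace_sum Dsub) => p.
  rewrite in_fset_set; last exact: L_aligned.
  rewrite inE => -[bp lp E _]; apply: GD; exists (pcomp a p.1), (pcomp m p.2).
  have [Xa Xb sab] := ab; have [Xl Xm slm] := lm.
  have ap : src a = rng p.1 by rewrite sab.
  have mp : src m = rng p.2 by rewrite -slm.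
  split=> //; split; rewrite ?rng_pcomp// !src_pcomp//.
  by rewrite -(src_pcomp bp) E src_pcomp.
Qed.

Lemma ck_generated_by_vertices (I : set A) : closed_ideal I ->
  (forall v, X v -> I (T (idp v) (idp v))) -> ck_generators `<=` I.
Proof.
move=> [_ _ _ IM] IX _ [a [b [ab ->]]]; have [Xa _ _] := ab.
have := ck_mul_vertexl Xa ab; rewrite eqxx => <-.
exact: (IM _ _ (IX _ Xa)).2.
Qed.

End CKFamily.

(** * Vertices whose projections lie in a closed ideal *)

Section VertexIdeal.
Context {R : realType} {k : nat} {L : kgraph k}.
Context {A : cstarType R} (T : kpath L -> kpath L -> A).
Hypothesis T_ck : ck_family [set: kvertex L] T.
Variable I : set A.
Hypothesis I_ideal : closed_ideal I.
Local Notation pv v := (T (idp v) (idp v)).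

Let indexT (a b : kpath L) : src a = src b -> ck_index [set: kvertex L] a b.
Proof. by []. Qed.

(** The two projections are equivalent through [T l (idp (src l))], so each is a product with the
    other as a factor. *)
Lemma ideal_vertex_path (l : kpath L) :
  I (pv (src l)) <-> I (T l l).
Proof.
have ll : ck_index setT l l by [].
have ls : ck_index setT l (idp (src l)) by split; rewrite ?src_idp.
have sl := ck_index_sym ls.
have ss : ck_index setT (idp (src l)) (idp (src l)) by [].
case: I_ideal => _ _ _ IM; split=> H.
  rewrite -(ck_mul_mid T_ck ls sl) -(ck_mul_mid T_ck ls ss) -cmulA.
  exact/(IM _ _ (IM _ _ H).2).1.
rewrite -(ck_mul_mid T_ck sl ls) -(ck_mul_mid T_ck sl ll) -cmulA.
exact/(IM _ _ (IM _ _ H).2).1.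
Qed.

Lemma vertex_ideal_hereditary : hereditary [set v | I (pv v)].
Proof.
move=> v Iv; apply/seteqP; split=> l; last by case.
move=> lv; split=> //; apply/ideal_vertex_path.
have := @ck_mul_vertexl _ _ _ _ _ _ T_ck v l l Logic.I (indexT erefl).
rewrite (_ : rng l = v)// eqxx => <-.
by case: I_ideal => _ _ _ IM; exact: (IM _ _ Iv).2.
Qed.

(** Modulo [I] every factor [pv v - T l l] equals [pv v], hence so does the product, which is zero
    by the Cuntz-Krieger relation. *)
Lemma vertex_ideal_saturated : saturated [set v | I (pv v)].
Proof.
move=> v [E [Ex EI]]; have Isub : closed_subspace I by case: I_ideal.
have [_ _ _ IM] := I_ideal; have [_ _ _ ck4] := T_ck.
have := ck4 v E Logic.I Ex.
have {}EI l : l \in enum_fset E -> I (T l l).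
  by move=> lE; apply/ideal_vertex_path; exact: (EI _ lE).2.
have fold (s : seq (kpath L)) x : (forall l, l \in s -> I (T l l)) ->
    I (x - pv v) -> I (foldl cmul x [seq pv v - T l l | l <- s] - pv v).
  elim: s x => //= l s IH x sI xI; apply: IH.
    by move=> n ns; apply: sI; rewrite inE ns orbT.
  have vv : pv v ** pv v = pv v by apply: (ck_mul_mid T_ck); exact: indexT.
  have -> : x ** (pv v - T l l) - pv v = (x - pv v) ** pv v - x ** T l l.
    by rewrite cmulBr cmulBl vv addrAC.
  apply: closed_subspaceD => //; first exact: (IM _ _ xI).2.
  apply: closed_subspaceN => //; apply: (IM _ _ _).1; apply: sI; exact: mem_head.
have : enum_fset E != [::].
  have [l lE] := exhaustive_neq0 Ex; have : l \in enum_fset E by [].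
  by case: (enum_fset E).
case: (enum_fset E) EI => // l s EI _ /= p0.
have : I (foldl cmul (pv v - T l l) [seq pv v - T l0 l0 | l0 <- s] - pv v).
  apply: fold => [n ns|]; first by apply: EI; rewrite inE ns orbT.
  rewrite addrAC subrr add0r; apply: closed_subspaceN => //.
  by apply: EI; exact: mem_head.
by rewrite p0 sub0r => /(closed_subspaceN Isub); rewrite opprK.
Qed.

End VertexIdeal.

Lemma linear_of_fun (K : pzRingType) (V W : lmodType K) (g : V -> W) :
  (forall (r : K) x y, g (r *: x + y) = r *: g x + g y) ->
  exists f : {linear V -> W}, f =1 g.
Proof.
move=> gL; pose gm := GRing.isLinear.Build K V W _ g gL.
by exists (HB.pack_for {linear V -> W} g gm).
Qed.

Lemma continuous_fmap (T : Type) (V W : topologicalType) (F : set_system T)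
  {FF : Filter F} (h : V -> W) (f : T -> V) (l : V) :
  continuous h -> f @ F --> l -> h (f t) @[t --> F] --> h l.
Proof. by move=> ch fl; apply: continuous_cvg fl; exact: ch. Qed.

(** * The projection P_X, its corner and fullness *)

Section VertexProjection.
Context {R : realType} {k : nat} {L : kgraph k} (X : set (kvertex L)).
Context {A : cstarType R} (T : kpath L -> kpath L -> A).
Hypotheses (L_aligned : finitely_aligned L) (T_ck : ck_family [set: kvertex L] T).
Implicit Types (a b l m : kpath L) (v w : kvertex L) (F : {fset kvertex L}).
Local Notation pv v := (T (idp v) (idp v)).

Definition partial_projection F : A := \sum_(v <- F | v \in X) pv v.

Lemma partial_projectionM F a b : src a = src b ->
  partial_projection F ** T a b =
  if (rng a \in F) && (rng a \in X) then T a b else 0.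
Proof.
move=> ab; rewrite cmul_suml (eq_bigr (fun v => if rng a == v then T a b else 0)).
  rewrite -big_mkcondr; case: ifPn => [/andP[aF aX]|aN].
    rewrite (big_rem _ aF)/= aX eqxx/= big_seq_cond big_pred0 ?addr0// => v.
    rewrite mem_rem_uniq ?fset_uniq// inE eq_sym.
    by apply/negP => /andP[/andP[/negP va _] /andP[_ /va]].
  rewrite big_seq_cond big_pred0// => v; apply/negP => /andP[vF /andP[vX /eqP av]].
  by move: aN; rewrite av vF vX.
by move=> v _; rewrite (ck_mul_vertexl T_ck).
Qed.

Lemma partial_projection_adj F : adj (partial_projection F) = partial_projection F.
Proof.
rewrite (big_morph _ (@adjD R A) (@adj0 R A)); apply: eq_bigr => v _.
exact: (ck_adj T_ck).
Qed.

Lemma partial_projection_idem F :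
  partial_projection F ** partial_projection F = partial_projection F.
Proof.
rewrite {2}/partial_projection cmul_sumr big_seq_cond [RHS]big_seq_cond.
by apply: eq_bigr => v /andP[vF vX]; rewrite partial_projectionM// rng_idp vF vX.
Qed.

Lemma partial_projection_le1 F : rnorm (partial_projection F) <= 1.
Proof.
have := rnorm_adjM (partial_projection F).
rewrite partial_projection_adj partial_projection_idem expr2.
have [->//|p0] := eqVneq (rnorm (partial_projection F)) 0.
have {}p0 : 0 < rnorm (partial_projection F) by rewrite lt0r p0 rnorm_ge0.
by rewrite -{1}(mulr1 (rnorm _)) => /(mulfI (lt0r_neq0 p0)) <-.
Qed.

Lemma partial_projection_gen_cvg a b : src a = src b ->
  partial_projection F ** T a b @[F --> totally] --> if rng a \in X then T a b else 0.
Proof.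
move=> ab; apply/cvg_rnormP => e e0; exists [fset rng a]%fset => // F /= aF.
rewrite partial_projectionM// (fsubsetP aF) ?inE//=.
by case: ifP => _; rewrite subrr rnorm0.
Qed.

Hypothesis T_gen : generated_by (ck_generators setT T).

(** On generators the net is eventually constant. The elements on which it converges form a closed
    subspace, since the partial projections have norm at most 1. *)
Lemma partial_projection_cvg x :
  exists y : A, partial_projection F ** x @[F --> totally] --> y.
Proof.
suff : [set x | exists y : A, partial_projection F ** x @[F --> totally] --> y] = setT.
  by move=> /seteqP[_]; apply.
apply: (ck_generators_dense L_aligned T_ck T_gen); last first.
  by move=> _ [a [b [[_ _ ab] ->]]]; eexists; exact: partial_projection_gen_cvg.
split.
- apply/closed_rnormP => z zD; apply: cauchy_rnorm => e e0.
  have e2 : 0 < e / 2 by rewrite divr_gt0.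
  have [z' [y z'y] zz'] := zD _ e2; exists y.
  apply: filterS ((cvg_rnormP _ _).1 z'y _ e2) => F yF.
  rewrite (le_lt_trans (rnorm_dist _ (partial_projection F ** z') _))// (splitr e) ltrD//.
  rewrite -cmulBr (le_lt_trans (rnormM _ _))// rnormC.
  by rewrite (le_lt_trans _ zz')// ler_piMl ?rnorm_ge0// partial_projection_le1.
- exists 0; under eq_cvg do rewrite cmul0r; exact: cvg_cst.
- move=> r z z' [y zy] [y' z'y']; exists (r *: y + y').
  under eq_cvg do rewrite cmulDr cmulZr.
  by apply: cvgD => //; apply: cvgZl_tmp.
Qed.

Lemma vertex_projection_exists : exists P : multiplier A, vertex_projection X T P.
Proof.
have [lm lmP] := choice partial_projection_cvg.
(* Right multiplication is obtained from left multiplication by adjoints, the partial projections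
   being self-adjoint. *)
pose rm x := adj (lm (adj x)).
have rmP x : x ** partial_projection F @[F --> totally] --> rm x.
  rewrite (_ : (fun F => _) = (fun F => adj (partial_projection F ** adj x))).
    by apply: continuous_cvg (lmP _); exact: adj_continuous.
  by apply/funext => F; rewrite adjM adjK partial_projection_adj.
have uniq (g : {fset kvertex L} -> A) (l l' : A) :
    g @ totally --> l -> g @ totally --> l' -> l = l'.
  exact: cvg_rnorm_unique.
have lmL (r : R[i]) x y : lm (r *: x + y) = r *: lm x + lm y.
  apply: uniq (lmP _) _; under eq_cvg do rewrite cmulDr cmulZr.
  by apply: cvgD => //; apply: cvgZl_tmp.
have rmL (r : R[i]) x y : rm (r *: x + y) = r *: rm x + rm y.
  by rewrite /rm adjD Defs.adjZ lmL adjD Defs.adjZ conjCK.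
have lm_le x : rnorm (lm x) <= rnorm x.
  apply/ler_addgt0Pr => e e0.
  have [F Fe] := filter_ex ((cvg_rnormP _ _).1 (lmP x) e e0).
  rewrite -(subrK (partial_projection F ** x) (lm x)) (le_trans (rnormD _ _))//.
  rewrite addrC lerD//; last exact: ltW.
  by rewrite (le_trans (rnormM _ _))// ler_piMl ?rnorm_ge0// partial_projection_le1.
have [lf lfE] := linear_of_fun lmL; have [rf rfE] := linear_of_fun rmL.
have lf_cont : continuous lf.
  by apply: (@lipschitz_rnorm _ _ _ _ 1) => x y; rewrite -linearB lfE mul1r.
have rf_cont : continuous rf.
  apply: (@lipschitz_rnorm _ _ _ _ 1) => x y; rewrite -linearB rfE mul1r.
  by rewrite rnorm_adj (le_trans (lm_le _))// rnorm_adj.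
have lfM x y : lf (x ** y) = lf x ** y.
  rewrite !lfE; apply: uniq (lmP _) _; under eq_cvg do rewrite cmulA.
  exact: (continuous_fmap (@cmulr_continuous _ _ y) (lmP x)).
have rfM x y : rf (x ** y) = x ** rf y.
  rewrite !rfE; apply: uniq (rmP _) _; under eq_cvg do rewrite -cmulA.
  exact: (continuous_fmap (@cmull_continuous _ _ x) (rmP y)).
have lrfM x y : x ** lf y = rf x ** y.
  rewrite lfE rfE.
  have h : x ** partial_projection F ** y @[F --> totally] --> rm x ** y.
    exact: (continuous_fmap (@cmulr_continuous _ _ y) (rmP x)).
  apply: uniq _ h; under eq_cvg do rewrite -cmulA.
  exact: (continuous_fmap (@cmull_continuous _ _ x) (lmP y)).
exists (Multiplier lf_cont rf_cont lfM rfM lrfM) => x /=; rewrite lfE rfE.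
by split; [exact: lmP | exact: rmP].
Qed.

Variable P : multiplier A.
Hypothesis TP : vertex_projection X T P.

Lemma lmultP x : partial_projection F ** x @[F --> totally] --> lmult P x.
Proof. exact: (TP x).1. Qed.

Lemma rmultP x : x ** partial_projection F @[F --> totally] --> rmult P x.
Proof. exact: (TP x).2. Qed.

Arguments lmultP : clear implicits.
Arguments rmultP : clear implicits.

Lemma lmult_gen a b : src a = src b ->
  lmult P (T a b) = if rng a \in X then T a b else 0.
Proof.
by move=> ab; apply: cvg_rnorm_unique (lmultP _) (partial_projection_gen_cvg ab).
Qed.

Lemma rmult_gen a b : src a = src b ->
  rmult P (T a b) = if rng b \in X then T a b else 0.
Proof.
move=> ab; apply: cvg_rnorm_unique (rmultP _) _.
rewrite (_ : (fun F => _) = (fun F => adj (partial_projection F ** T b a))).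
  rewrite (_ : (if _ then _ else _) = adj (if rng b \in X then T b a else 0)).
    apply: continuous_cvg (partial_projection_gen_cvg (esym ab)).
    exact: adj_continuous.
  by case: ifP; rewrite ?adj0 ?(ck_adj T_ck).
by apply/funext => F; rewrite adjM partial_projection_adj (ck_adj T_ck).
Qed.

Lemma corner_gen a b : src a = src b ->
  lmult P (rmult P (T a b)) = if (rng a \in X) && (rng b \in X) then T a b else 0.
Proof.
move=> ab; rewrite rmult_gen//; case: ifP => _; rewrite ?andbT ?andbF ?linear0//.
exact: lmult_gen.
Qed.

Lemma closed_subspace_range (B : cstarType R) (f : {linear B -> A}) :
  star_hom f -> closed_subspace (range f).
Proof.
move=> fhom; split; first exact: star_hom_closed_range.
  by exists 0; rewrite ?linear0.
by move=> r _ _ [x _ <-] [y _ <-]; exists (r *: x + y); rewrite ?linearP.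
Qed.

(** Both inclusions are checked on generators. The first uses that compression by [P] is continuous;
    the second also that the range of [f] is closed. *)
Lemma corner_range (B : cstarType R) (U : kpath L -> kpath L -> B)
  (f : {linear B -> A}) : ck_family X U -> generated_by (ck_generators X U) ->
  star_hom f -> (forall a b, ck_index X a b -> f (U a b) = T a b) ->
  range f = corner P.
Proof.
move=> U_ck U_gen fhom fU; apply/seteqP; split=> [_ [b _ <-]|_ [x _ <-]].
  exists (f b) => //; move: b.
  suff : [set b | lmult P (rmult P (f b)) = f b] = setT.
    by move=> /seteqP[_ h] b; exact: h.
  apply: (ck_generators_dense L_aligned U_ck U_gen); last first.
    move=> _ [a [b [ab ->]]] /=; rewrite fU//; case: (ab) => Xa Xb sab.
    by rewrite corner_gen// (mem_set Xa) (mem_set Xb).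
  have fc := star_hom_continuous fhom; split.
  - apply: closed_equalizer => // b.
    have h : rmult P (f b') @[b' --> b] --> rmult P (f b).
      exact: (continuous_fmap (@rmult_continuous _ _ P) (fc b)).
    exact: (continuous_fmap (@lmult_continuous _ _ P) h).
  - by rewrite /= !linear0.
  - by move=> r b b' /= Pb Pb'; rewrite !linearP Pb Pb'.
suff : [set x | range f (lmult P (rmult P x))] = setT by move=> /seteqP[_]; apply.
apply: (ck_generators_dense L_aligned T_ck T_gen).
  apply: (@closed_subspace_preimage _ _ _ (fun x => lmult P (rmult P x))).
  - move=> z; apply: (continuous_fmap (@lmult_continuous _ _ P)).
    exact: rmult_continuous.
  - by move=> r y z; rewrite !linearP.
  - exact: closed_subspace_range.
move=> _ [a [b [[_ _ ab] ->]]] /=; rewrite corner_gen//.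
case: ifP => [/andP[/set_mem Xa /set_mem Xb]|_]; last by exists 0; rewrite ?linear0.
by exists (U a b) => //; apply: fU.
Qed.

Lemma corner_full : saturation X = setT -> ideal_generated P = setT.
Proof.
move=> XT; apply/seteqP; split=> // x _ I [I_ideal IP].
suff -> : I = setT by [].
apply: (ck_generators_dense L_aligned T_ck T_gen); first by case: I_ideal.
apply: (ck_generated_by_vertices T_ck I_ideal) => v _.
have Xv : saturation X v by rewrite XT.
apply: (Xv [set v | I (pv v)]); split.
- exact: (vertex_ideal_saturated T_ck I_ideal).
- exact: (vertex_ideal_hereditary T_ck I_ideal).
(* For [w] in [X] the element [pv w ** lmult P (pv w)] of [I] is [pv w] itself. *)
move=> w Xw /=; have := IP (pv w) (pv w).
by rewrite lmult_gen// rng_idp (mem_set Xw) (ck_mul_mid T_ck).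
Qed.

Lemma full_saturation (S : set (kvertex L)) :
  (forall (C : cstarType R) (V : kpath L -> kpath L -> C),
    ck_family [set: kvertex L] V ->
    exists2 f : {linear A -> C}, star_hom f & forall a b,
      ck_index [set: kvertex L] a b -> f (T a b) = V a b) ->
  ideal_generated P = setT -> saturated S -> hereditary S -> X `<=` S -> S = setT.
Proof.
move=> univ Pfull Ssat Sher XS; apply/seteqP; split=> // w _.
apply: contrapT => wS.
have [f fhom fT] := univ _ _ (@rep_ck_family R _ _ _ L_aligned Sher).
have f0 v : S v -> f (pv v) = 0 by move=> Sv; rewrite fT// rep_vanish.
have ker_ideal : closed_ideal [set x | f x = 0].
  split.
  - apply: (@closed_equalizer _ _ _ f (fun=> 0)); first exact: star_hom_continuous.
    by move=> x; exact: cvg_cst.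
  - by rewrite /= linear0.
  - by move=> r x y /= fx fy; rewrite linearP fx fy scaler0 addr0.
  - by move=> x y /= fy; rewrite !fhom.1 fy cmul0l cmul0r.
have : ideal_generated P (pv w) by rewrite Pfull.
(* Fullness would put [pv w] in the kernel of [f], once the kernel is seen to contain the generators
   of the ideal. *)
move=> /(_ _ (conj ker_ideal _)) fw; apply: (@rep_neq0 R _ _ _ L_aligned Sher w Ssat wS).
rewrite -(fT (idp w) (idp w))//; apply: fw => a b /=.
rewrite fhom.1; suff -> : f (lmult P b) = 0 by rewrite cmul0r.
have fc := star_hom_continuous fhom.
(* By continuity [f (lmult P b)] is a limit of zeros: each partial projection is a sum of [pv v]
   with [v] in [X], all killed by [f]. *)
have : f (partial_projection F ** b) @[F --> totally] --> f (lmult P b).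
  by apply: continuous_cvg (lmultP b); exact: fc.
rewrite (_ : (fun F => _) = (fun F => 0)) => [h|].
  by apply: cvg_rnorm_unique h _; exact: cvg_cst.
apply/funext => F; rewrite fhom.1 linear_sum big1 ?cmul0l// => v /set_mem Xv.
by apply: f0; exact: XS.
Qed.

End VertexProjection.

Theorem corollary4p4 (R : realType) (k : nat) (L : kgraph k)
    (L_aligned : finitely_aligned L)
    (X : set (kvertex L)) (X_neq0 : X !=set0)
    (A : cstarType R) (T : kpath L -> kpath L -> A)
    (A_univ : universal_ck [set: kvertex L] T)
    (B : cstarType R) (U : kpath L -> kpath L -> B)
    (B_univ : universal_ck X U) :
  full_corner X T U <-> saturation X = [set: kvertex L].
Proof.
have [T_ck T_gen T_univ] := A_univ; have [U_ck U_gen U_univ] := B_univ.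
split=> [[f [P [_ _ TP _ Pfull]]]|XT].
  apply/seteqP; split=> // w _ S [Ssat Sher XS].
  by rewrite (full_saturation L_aligned TP T_univ Pfull Ssat Sher XS).
have [P TP] := vertex_projection_exists X L_aligned T_ck T_gen.
(* The relations restrict to indices with ranges in [X], and universality of [U] then supplies the
   map [f]. *)
have T_ckX : ck_family X T.
  have [T1 T2 T3 T4] := T_ck; split.
  - by move=> a b [_ _ ab]; exact: T1.
  - by move=> a b [_ _ ab]; exact: T2.
  - by move=> a b l m [_ _ ab] [_ _ lm]; exact: T3.
  - by move=> v E _; exact: T4.
have [f fhom fU] := U_univ _ _ T_ckX.
exists f, P; split=> //.
  exact: (corner_range L_aligned T_ck T_gen TP U_ck U_gen fhom fU).
exact: (corner_full L_aligned T_ck T_gen TP XT).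
Qed.
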